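(* Let $\sigma$ be a SODE on $M$. The Chern connection $\nabla^\sigma$ attached to $\sigma$ (a linear connection on $M^1$) is reducible to the $G$-structure $P^\sigma$ of linear frames of $M^1$ adapted to $\sigma$.
   Context: $M$ is a connected smooth manifold of dimension $n$; $M^0=\mathbb{R}\times M$ with projections $p\colon M^0\to\mathbb{R}$, $p'\colon M^0\to M$; $M^r=J^r(\mathbb{R},M)$ is the manifold of $r$-jets of smooth maps $\mathbb{R}\to M$, with projections $p^{rs}\colon M^r\to M^s$. Coordinates $(x^i)$ on $M$ induce coordinates $(t,x^i,\dot x^i)$ on $M^1$ and $(t,x^i,\dot x^i,\ddot x^i)$ on $M^2$. The summation convention is used. A SODE on $M$ is a smooth section $\sigma\colon M^1\to M^2$ of $p^{21}$; in coordinates $F^i=\ddot x^i\circ\sigma$. Put $X^\sigma=\frac{\partial}{\partial t}+\dot x^i\frac{\partial}{\partial x^i}+F^i\frac{\partial}{\partial\dot x^i}$ (globally defined), $X^\sigma_i=\frac{\partial}{\partial x^i}+\frac12\frac{\partial F^j}{\partial\dot x^i}\frac{\partial}{\partial\dot x^j}$, $\omega^i=dx^i-\dot x^idt$. $V(p^{10})$ is the bundle of $p^{10}$-vertical vectors; $\varepsilon\colon(p'\circ p^{10})^*TM\to V(p^{10})$ is the canonical isomorphism $\varepsilon(\partial/\partial x^i)=\partial/\partial\dot x^i$; $H^\sigma\colon(p^{10})^*TM^0\to TM^1$ is $H^\sigma=dt\otimes X^\sigma+\omega^i\otimes X^\sigma_i$; $(p'\circ p^{10})^*TM\subset(p^{10})^*TM^0$.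 A linear frame $(X_0,\dots,X_{2n})$ of $T_\xi M^1$ is adapted to $\sigma$ if $X_0=(X^\sigma)_\xi$, $X_{n+i}$ is $p^{10}$-vertical, and $X_i=(H^\sigma\circ\varepsilon^{-1})(X_{n+i})$ for $1\le i\le n$. The adapted frames form a $G$-structure $P^\sigma\subset F(M^1)$, where $G=\{\mathrm{diag}(1,\Lambda,\Lambda):\Lambda\in Gl(n,\mathbb{R})\}\subset Gl(2n+1,\mathbb{R})$. The Chern connection $\nabla^\sigma$ is the linear connection on $M^1$ given in every induced coordinate system by $\nabla^\sigma_YX^\sigma=0$ for all $Y$; $\nabla^\sigma_{X^\sigma}X^\sigma_i=-\frac12\frac{\partial F^j}{\partial\dot x^i}X^\sigma_j$, $\nabla^\sigma_{X^\sigma}\frac{\partial}{\partial\dot x^i}=-\frac12\frac{\partial F^j}{\partial\dot x^i}\frac{\partial}{\partial\dot x^j}$; $\nabla^\sigma_{X^\sigma_j}X^\sigma_i=-\frac12\frac{\partial^2F^k}{\partial\dot x^i\partial\dot x^j}X^\sigma_k$, $\nabla^\sigma_{X^\sigma_j}\frac{\partial}{\partial\dot x^i}=-\frac12\frac{\partial^2F^k}{\partial\dot x^i\partial\dot x^j}\frac{\partial}{\partial\dot x^k}$; $\nabla^\sigma_{\partial/\partial\dot x^j}X^\sigma_i=0$, $\nabla^\sigma_{\partial/\partial\dot x^j}\frac{\partial}{\partial\dot x^i}=0$. *)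

(* Defs.v *)
From HB Require Import structures.
From mathcomp Require Import all_boot all_order all_algebra.
From mathcomp Require Import all_classical all_reals all_analysis.

Set Implicit Arguments.
Unset Strict Implicit.
Unset Printing Implicit Defensive.

Import Order.TTheory GRing.Theory Num.Theory.
Import numFieldNormedType.Exports.

Local Open Scope classical_set_scope.
Local Open Scope ring_scope.

Section Smooth.
Context {R : realType} {V W : normedModType R}.

(* In finite dimension, f is C^(k+1) on the open set U iff f is differentiable
   on U and x |-> (df)_x v is C^k on U for every vector v. *)
Fixpoint Ck (k : nat) (U : set V) (f : V -> W) : Prop :=
  match k with
  | 0 => forall x, U x -> {for x, continuous f}
  | k'.+1 => (forall x, U x -> differentiable f x) /\
             forall v, Ck k' U (fun x => 'd f x v)
  end.

Definition smooth_on (U : set V) (f : V -> W) : Prop := forall k, Ck k U f.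

Definition smooth_near (f : V -> W) (x : V) : Prop :=
  exists2 U, open_nbhs x U & smooth_on U f.

End Smooth.

(* The charts are indexed by a type; coord i is meaningful only on dom i. *)
Record atlas (R : realType) (n : nat) (T : Type) := Atlas {
  chart : Type ;
  dom : chart -> set T ;
  coord : chart -> T -> 'rV[R]_n }.

Section Atlas.
Context {R : realType} {n : nat} {T : Type}.
Variable A : atlas R n T.

(* Local representative f \o (coord i)^-1, extended by a default value off
   coord i @` dom i. *)
Definition rep (V : choiceType) (v0 : V) (i : chart A) (f : T -> V)
    (x : 'rV[R]_n) : V :=
  xget v0 [set f p | p in [set p | dom i p /\ coord i p = x]].

Definition transition (i j : chart A) : 'rV[R]_n -> 'rV[R]_n :=
  rep 0 i (coord j).

Record smooth_atlas : Prop := SmoothAtlas {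
  atlas_cover : forall p, exists i : chart A, dom i p ;
  atlas_inj : forall i : chart A, set_inj (dom i) (coord i) ;
  atlas_open : forall i j : chart A, open (coord i @` (dom i `&` dom j)) ;
  atlas_smooth : forall i j : chart A,
    smooth_on (coord i @` (dom i `&` dom j)) (transition i j) }.

(* P holds on a neighbourhood of p for the topology induced by the atlas. *)
Definition near_pt (p : T) (P : T -> Prop) : Prop :=
  forall i : chart A, dom i p ->
    \forall x \near coord i p, forall q, dom i q -> coord i q = x -> P q.

Definition smooth_fun_at (f : T -> R) (p : T) : Prop :=
  forall i : chart A, dom i p -> smooth_near (rep 0 i f) (coord i p).

Definition smooth_curve_at (c : R -> T) (t : R) : Prop :=
  forall i : chart A, dom i (c t) ->
    (\forall s \near t, dom i (c s)) /\ smooth_near (coord i \o c) t.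

(* A tangent vector is the family of its coordinate vectors in the charts around
   its base point, padded with 0 in the other charts so that equality of
   tangent vectors is equality of families. *)
Definition tvec := chart A -> 'rV[R]_n.

Definition is_tangent (p : T) (v : tvec) : Prop :=
  (forall i, ~ dom i p -> v i = 0) /\
  (forall i j, dom i p -> dom j p ->
     v j = 'd (transition i j) (coord i p) (v i)).

Definition velocity (c : R -> T) : tvec :=
  fun i => if `[< dom i (c 0) >] then derive1 (coord i \o c) 0 else 0.

Definition smooth_field_at (X : T -> tvec) (p : T) : Prop :=
  near_pt p (fun q => is_tangent q (X q)) /\
  forall i : chart A, dom i p ->
    smooth_near (rep 0 i (fun q => X q i)) (coord i p).

(* The vector field on dom i with components x in the coordinates coord i. *)
Definition chart_field (i : chart A) (x : T -> 'rV[R]_n) : T -> tvec :=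
  fun q j => if `[< dom i q /\ dom j q >]
             then 'd (transition i j) (coord i q) (x q) else 0.

(* A covariant derivative acts on germs: nabla p v X is the derivative at p,
   along the tangent vector v at p, of a vector field X that is smooth near p
   (X is a total function; its values away from p are irrelevant, and
   nabla p v X is unspecified when X is not smooth at p). *)
Definition covariant_derivative := T -> tvec -> (T -> tvec) -> tvec.

Record linear_connection (nabla : covariant_derivative) : Prop :=
  LinearConnection {
  conn_tangent : forall p v X, is_tangent p v -> smooth_field_at X p ->
    is_tangent p (nabla p v X) ;
  conn_linear : forall p (a : R) v w X,
    is_tangent p v -> is_tangent p w -> smooth_field_at X p ->
    nabla p (a *: v + w) X = a *: nabla p v X + nabla p w X ;
  conn_additive : forall p v X X', is_tangent p v ->
    smooth_field_at X p -> smooth_field_at X' p ->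
    nabla p v (fun q => X q + X' q) = nabla p v X + nabla p v X' ;
  conn_leibniz : forall p v (f : T -> R) X, is_tangent p v ->
    smooth_fun_at f p -> smooth_field_at X p ->
    forall i : chart A, dom i p ->
      nabla p v (fun q => f q *: X q) i =
      'd (rep 0 i f) (coord i p) (v i) *: X p i + f p *: nabla p v X i ;
  conn_smooth : forall p X Y, smooth_field_at X p -> smooth_field_at Y p ->
    smooth_field_at (fun q => nabla q (Y q) X) p }.

(* Linear frames, as families (X_a) of tangent vectors. *)
Definition frame_matrix (X : 'I_n -> tvec) (i : chart A) : 'M[R]_n :=
  \matrix_(a, k) X a i 0 k.

Definition is_frame (p : T) (X : 'I_n -> tvec) : Prop :=
  (forall a, is_tangent p (X a)) /\
  (forall i, dom i p -> frame_matrix X i \in unitmx).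

Definition frame_bundle := {u : T * ('I_n -> tvec) | is_frame u.1 u.2}.

Definition base (u : frame_bundle) : T := (sval u).1.
Definition frame_of (u : frame_bundle) : 'I_n -> tvec := (sval u).2.

Definition frame_atlas : atlas R (n + n * n) frame_bundle :=
  {| chart := chart A ;
     dom := fun i => [set u | dom i (base u)] ;
     coord := fun i u =>
       row_mx (coord i (base u)) (mxvec (frame_matrix (frame_of u) i)) |}.

End Atlas.

Arguments tvec {R n T} A.
Arguments covariant_derivative {R n T} A.
Arguments frame_bundle {R n T} A.
Arguments frame_atlas {R n T} A.
Arguments smooth_atlas {R n T} A.

Section Maps.
Context {R : realType} {m n : nat} {S T : Type}.
Variables (A : atlas R m S) (B : atlas R n T).

Definition smooth_map_at (f : S -> T) (p : S) : Prop :=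
  forall j : chart B, dom j (f p) ->
    near_pt A p (fun q => dom j (f q)) /\
    forall i : chart A, dom i p ->
      smooth_near (rep 0 i (coord j \o f)) (coord i p).

Definition smooth_map (f : S -> T) : Prop := forall p, smooth_map_at f p.

(* f-vertical vectors: those in the kernel of the tangent map of f at p. *)
Definition vertical (f : S -> T) (p : S) (v : tvec A) : Prop :=
  is_tangent p v /\
  forall (i : chart A) (j : chart B), dom i p -> dom j (f p) ->
    'd (rep 0 i (coord j \o f)) (coord i p) (v i) = 0.

End Maps.

Record connected_manifold (R : realType) (n : nat) (M : topologicalType)
    (A : atlas R n M) : Prop := ConnectedManifold {
  manifold_atlas : smooth_atlas A ;
  manifold_topology : forall O : set M,
    open O <-> forall i : chart A, open (coord i @` (O `&` dom i)) ;
  manifold_hausdorff : hausdorff_space M ;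
  manifold_countable : @second_countable M ;
  manifold_connected : connected [set: M] }.

Section GStructures.
Context {R : realType} {n : nat} {T : Type}.
Variable A : atlas R n T.

(* Right action of matrices on frames: (X g)_b = X_a g^a_b. *)
Definition frame_act (X : 'I_n -> tvec A) (g : 'M[R]_n) : 'I_n -> tvec A :=
  fun b => \sum_a g a b *: X a.

Record G_structure (G : set 'M[R]_n) (Q : set (frame_bundle A)) : Prop :=
  GStructure {
  gstr_orbit : forall u u', base u = base u' -> Q u ->
    (Q u' <-> exists2 g, G g & frame_of u' = frame_act (frame_of u) g) ;
  gstr_section : forall p, exists s : T -> frame_bundle A,
    near_pt A p (fun q => base (s q) = q /\ Q (s q)) /\
    smooth_map_at A (frame_atlas A) s p }.

(* T_u Q, as the set of velocities of the smooth curves of the frame bundle that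
   lie in the submanifold Q. *)
Definition tangent_to (Q : set (frame_bundle A)) (u : frame_bundle A) :
    set (tvec (frame_atlas A)) :=
  [set W : tvec (frame_atlas A) | exists c : R -> frame_bundle A,
     [/\ c 0 = u, smooth_curve_at (frame_atlas A) c 0,
         \forall s \near 0, Q (c s) & W = velocity c]].

Definition base_part (W : tvec (frame_atlas A)) : tvec A :=
  fun i => lsubmx (W i).

(* The horizontal subspace at u = (p, X) of the connection in the frame bundle
   defined by nabla.  In the coordinates (x^k, X^k_a) of the frame bundle it is
   the set of vectors (x', X') with X'^k_a + Gamma^k_{jl} x'^j X^l_a = 0; the
   second term is the covariant derivative, along x', of the local field whose
   components are constant and equal to those of X_a. *)
Definition horizontal (nabla : covariant_derivative A) (u : frame_bundle A) :
    set (tvec (frame_atlas A)) :=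
  [set W : tvec (frame_atlas A) | is_tangent u W /\
     forall i : chart A, dom i (base u) -> forall a,
       row a (vec_mx (rsubmx (W i))) +
       nabla (base u) (base_part W)
         (chart_field i (fun=> frame_of u a i)) i = 0].

(* The horizontal subspaces at the points of the reduced bundle Q are tangent to
   Q, i.e. the connection restricts to a connection in Q. *)
Definition reducible_to (nabla : covariant_derivative A) (G : set 'M[R]_n)
    (Q : set (frame_bundle A)) : Prop :=
  G_structure G Q /\
  forall u, Q u -> horizontal nabla u `<=` tangent_to Q u.

End GStructures.

Section Jets.
Context {R : realType} {n : nat} {M : Type}.
Variable A : atlas R n M.

Definition same_jet (r : nat) (a b : R * (R -> M)) : Prop :=
  [/\ a.1 = b.1, a.2 a.1 = b.2 b.1 &
      forall i : chart A, dom i (a.2 a.1) -> forall k, (k <= r)%N ->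
        derive1n k (coord i \o a.2) a.1 = derive1n k (coord i \o b.2) b.1].

Definition jet_class (r : nat) (a : R * (R -> M)) : set (R * (R -> M)) :=
  [set b | smooth_curve_at A b.2 b.1 /\ same_jet r a b].

(* J^r(R, M): the classes of pairs (t, c), with c smooth near t. *)
Definition jet (r : nat) :=
  {J : set (R * (R -> M)) |
    exists2 a, smooth_curve_at A a.2 a.1 & J = jet_class r a}.

Definition jet_of (r : nat) (a : R * (R -> M)) (h : smooth_curve_at A a.2 a.1) :
  jet r := exist _ (jet_class r a) (ex_intro2 _ _ a h erefl).

Definition jet_curve r (J : jet r) : R * (R -> M) := s2val (cid2 (svalP J)).

Definition jet_curveP r (J : jet r) :
  smooth_curve_at A (jet_curve J).2 (jet_curve J).1 :=
  s2valP (cid2 (svalP J)).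
Arguments jet_curveP [r] J.

Definition source r (J : jet r) : R := (jet_curve J).1.
Definition target r (J : jet r) : M := (jet_curve J).2 (jet_curve J).1.

Definition p21 (J : jet 2) : jet 1 := jet_of 1 (jet_curveP J).
Definition p10 (J : jet 1) : R * M := (source J, target J).

Definition jet_deriv r (J : jet r) (i : chart A) (k : nat) : 'rV[R]_n :=
  derive1n k (coord i \o (jet_curve J).2) (jet_curve J).1.

(* Induced coordinates (t, x) on R x M, (t, x, x') on the 1-jets and
   (t, x, x', x'') on the 2-jets. *)
Definition atlas0 : atlas R (1 + n) (R * M) :=
  {| chart := chart A ;
     dom := fun i => [set q | dom i q.2] ;
     coord := fun i q => row_mx q.1%:M (coord i q.2) |}.

Definition atlas1 : atlas R (1 + (n + n)) (jet 1) :=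
  {| chart := chart A ;
     dom := fun i => [set J | dom i (target J)] ;
     coord := fun i J =>
       row_mx (source J)%:M
         (row_mx (coord i (target J)) (jet_deriv J i 1)) |}.

Definition atlas2 : atlas R (1 + (n + (n + n))) (jet 2) :=
  {| chart := chart A ;
     dom := fun i => [set J | dom i (target J)] ;
     coord := fun i J =>
       row_mx (source J)%:M
         (row_mx (coord i (target J))
            (row_mx (jet_deriv J i 1) (jet_deriv J i 2))) |}.

Definition SODE (sigma : jet 1 -> jet 2) : Prop :=
  smooth_map atlas1 atlas2 sigma /\ forall xi, p21 (sigma xi) = xi.

Section ChernConnection.
Variable sigma : jet 1 -> jet 2.

Definition acceleration (i : chart A) (xi : jet 1) : 'rV[R]_n :=
  rsubmx (rsubmx (rsubmx (coord (a := atlas2) i (sigma xi)))).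

(* F^j in terms of the coordinates (t, x, x'). *)
Definition Fcoord (i : chart A) : 'rV[R]_(1 + (n + n)) -> 'rV[R]_n :=
  rep (A := atlas1) 0 i (acceleration i).

Definition coord1 (i : chart A) (xi : jet 1) : 'rV[R]_(1 + (n + n)) :=
  coord (a := atlas1) i xi.

(* Components of the coordinate vector field d/dx'^k. *)
Definition ddx1 (k : 'I_n) : 'rV[R]_(1 + (n + n)) :=
  row_mx 0 (row_mx 0 (delta_mx 0 k)).

(* dF i k j xi = dF^j/dx'^k and d2F i k l j xi = d^2F^j/dx'^k dx'^l at xi. *)
Definition dF (i : chart A) (k j : 'I_n) (xi : jet 1) : R :=
  ('D_(ddx1 k) (Fcoord i) (coord1 i xi)) 0 j.
Definition d2F (i : chart A) (k l j : 'I_n) (xi : jet 1) : R :=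
  ('D_(ddx1 k) ('D_(ddx1 l) (Fcoord i)) (coord1 i xi)) 0 j.

(* Components, in the i-th induced chart, of X^sigma and X^sigma_k. *)
Definition Xsigma_coord (i : chart A) (xi : jet 1) : 'rV[R]_(1 + (n + n)) :=
  row_mx 1 (row_mx (jet_deriv xi i 1) (acceleration i xi)).
Definition Xh_coord (i : chart A) (k : 'I_n) (xi : jet 1) :
    'rV[R]_(1 + (n + n)) :=
  row_mx 0 (row_mx (delta_mx 0 k) (2^-1 *: \row_j dF i k j xi)).

Definition Xsigma (xi : jet 1) : tvec atlas1 :=
  fun i => if `[< dom i xi >] then Xsigma_coord i xi else 0.

Definition Xh (i : chart A) (k : 'I_n) : jet 1 -> tvec atlas1 :=
  chart_field (A := atlas1) i (Xh_coord i k).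
Definition Xv (i : chart A) (k : 'I_n) : jet 1 -> tvec atlas1 :=
  chart_field (A := atlas1) i (fun=> ddx1 k).

Record chern_connection (nabla : covariant_derivative atlas1) : Prop :=
  ChernConnection {
  chern_linear : linear_connection nabla ;
  chern_X : forall xi Y, is_tangent xi Y -> nabla xi Y Xsigma = 0 ;
  chern_Xh : forall (i : chart A) xi, dom (a := atlas1) i xi -> forall k,
    nabla xi (Xsigma xi) (Xh i k) =
    - (2^-1 *: \sum_j dF i k j xi *: Xh i j xi) ;
  chern_Xv : forall (i : chart A) xi, dom (a := atlas1) i xi -> forall k,
    nabla xi (Xsigma xi) (Xv i k) =
    - (2^-1 *: \sum_j dF i k j xi *: Xv i j xi) ;
  chern_hh : forall (i : chart A) xi, dom (a := atlas1) i xi -> forall k l,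
    nabla xi (Xh i l xi) (Xh i k) =
    - (2^-1 *: \sum_j d2F i k l j xi *: Xh i j xi) ;
  chern_hv : forall (i : chart A) xi, dom (a := atlas1) i xi -> forall k l,
    nabla xi (Xh i l xi) (Xv i k) =
    - (2^-1 *: \sum_j d2F i k l j xi *: Xv i j xi) ;
  chern_vh : forall (i : chart A) xi, dom (a := atlas1) i xi -> forall k l,
    nabla xi (Xv i l xi) (Xh i k) = 0 ;
  chern_vv : forall (i : chart A) xi, dom (a := atlas1) i xi -> forall k l,
    nabla xi (Xv i l xi) (Xv i k) = 0 }.

(* The canonical isomorphism T_x M -> V_xi(p^10), d/dx^k |-> d/dx'^k. *)
Definition epsilon (v : tvec A) : tvec atlas1 :=
  fun i => row_mx 0 (row_mx 0 (v i)).

(* The inclusion T_x M -> T_(t, x)(R x M). *)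
Definition spatial (v : tvec A) : tvec atlas0 := fun i => row_mx 0 (v i).

(* H^sigma = dt (x) X^sigma + omega^k (x) X^sigma_k at xi. *)
Definition Hsigma (xi : jet 1) (w : tvec atlas0) : tvec atlas1 :=
  fun i =>
    let dt := lsubmx (w i) 0 0 in
    let omega k := rsubmx (w i) 0 k - jet_deriv xi i 1 0 k * dt in
    if `[< dom i xi >]
    then dt *: Xsigma_coord i xi + \sum_k omega k *: Xh_coord i k xi
    else 0.

Definition X0_index : 'I_(1 + (n + n)) := lshift (n + n) ord0.
Definition Xh_index (k : 'I_n) : 'I_(1 + (n + n)) := rshift 1 (lshift n k).
Definition Xv_index (k : 'I_n) : 'I_(1 + (n + n)) := rshift 1 (rshift n k).

Definition adapted_frames : set (frame_bundle atlas1) :=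
  [set u | frame_of u X0_index = Xsigma (base u) /\
     forall k : 'I_n,
       vertical atlas0 p10 (base u) (frame_of u (Xv_index k)) /\
       exists v : tvec A,
         [/\ is_tangent (target (base u)) v,
             frame_of u (Xv_index k) = epsilon v &
             frame_of u (Xh_index k) = Hsigma (base u) (spatial v)]].

End ChernConnection.

End Jets.

(* diag(1, L, L) with L in GL(n, R). *)
Definition adapted_group (R : realType) (n : nat) :
    set 'M[R]_(1 + (n + n)) :=
  [set g | exists2 L : 'M[R]_n, L \in unitmx &
     g = block_mx 1%:M 0 0 (block_mx L 0 0 L)].

Arguments adapted_group R n : clear implicits.

(* Main.v *)
Require Import Defs.
From HB Require Import structures.
From mathcomp Require Import all_boot all_order all_algebra.
From mathcomp Require Import all_classical all_reals all_analysis.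
From mathcomp Require Import perm ring lra.

Set Implicit Arguments.
Unset Strict Implicit.
Unset Printing Implicit Defensive.

Import Order.TTheory GRing.Theory Num.Theory.
Import numFieldNormedType.Exports Defs.

Local Open Scope classical_set_scope.
Local Open Scope ring_scope.

(** In an induced chart, a frame of the manifold of 1-jets is adapted exactly when
    its matrix of components is diag(1, L, L) P(x) with L invertible, where the
    rows of P(x) are the components of X^sigma, X^sigma_k and d/dx'^k at the point
    with coordinates x ([adapted_framesP]). Over a given point two such matrices
    differ by a factor diag(1, K, K), and L = 1 gives smooth local sections: the
    adapted frames form a G-structure ([adapted_G_structure]).

    This uses that X^sigma and the horizontal lift of a spatial vector do not
    depend on the chart. For X^sigma this is the second-order chain rule
    ([jet_deriv2_transition], [Xsigma_tangent]). For horizontal lifts one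
    differentiates the transformation law of F along the fibres; as second
    derivatives are symmetric ([diff_diffC]), its term quadratic in the velocity
    contributes twice the same vector ([diff_Fcoord_transition]), which the factor
    1/2 in X^sigma_k turns into the one that the tangent map of a change of
    coordinates produces ([Hsigma_spatial_tangent]).

    The Chern connection is reducible because its matrix in an adapted frame lies
    in the Lie algebra of G: nabla_Y kills X^sigma and acts on the X^sigma_k and on
    the d/dx'^k by the same matrix Theta(Y) ([conn_adapted_field]). Comparing the
    moving adapted frame with the fields of constant components
    ([conn_chart_field]), a horizontal vector at the frame diag(1, L, L) P(x) over
    the velocity x' has fibre component
       diag(1, L, L) dP(x') - diag(0, Theta', Theta') P(x)
    with Theta' = L Theta ([horizontal_coord]). It is the derivative at s = 0 of
       diag(1, L - s Theta', L - s Theta') P(x + s x'),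
    which is the matrix of an adapted frame for every small s
    ([horizontal_tangent]).

    Coordinate computations suffice because the charts of the 1-jets and of the
    frame bundle form smooth atlases ([smooth_atlas1], [smooth_frame_atlas]): then
    tangent vectors may be compared in one chart ([tangent_eq]) and a curve given in
    coordinates is the image of a smooth curve ([lift_curve]). *)

(** * Calculus of smooth maps *)

Section Locality.
Context {R : realType} {V W : normedModType R}.
Implicit Types (f g : V -> W) (x v : V).

Let near_eq_expansion f g x : (\near x, f x = g x) -> differentiable f x ->
  g \o shift x = cst (g x) + 'd f x +o_ 0 id.
Proof.
move=> fg df; have /eqaddoP dfP := diff_locally df.
apply/eqaddoP => e /dfP; have := fg; rewrite (near_shift 0) subr0 => fg0.
apply: filterS2 fg0 => h /= fgh.
by rewrite /= -![(_ + _ : _ -> _) _]/(_ + _) -![(- _ : _ -> _) _]/(- _) /=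
  fgh (nbhs_singleton fg).
Qed.

(** Differentiability and the differential only see the germ of a map, since the
    expansion f (x + h) = f x + df h + o(h) does. *)
Lemma near_eq_differentiable f g x :
  (\near x, f x = g x) -> differentiable f x -> differentiable g x.
Proof.
move=> fg df; have E := near_eq_expansion fg df.
apply/diff_locallyP; rewrite (diff_unique (diff_continuous df) E).
by split; [exact: diff_continuous|].
Qed.

Lemma near_eq_diff f g x :
  (\near x, f x = g x) -> differentiable f x -> 'd f x = 'd g x :> (V -> W).
Proof.
move=> fg df; apply/esym/(diff_unique (diff_continuous df)).
exact: near_eq_expansion.
Qed.

Lemma near_eq_diffE f g x v :
  (\near x, f x = g x) -> differentiable f x -> 'd f x v = 'd g x v.
Proof. by move=> fg df; exact: (congr1 (fun h => h v) (near_eq_diff fg df)). Qed.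

End Locality.

Lemma diff_compE (R : realType) (V W Z : normedModType R) (h : W -> Z)
    (f : V -> W) x v : differentiable f x -> differentiable h (f x) ->
  'd (fun y => h (f y)) x v = 'd h (f x) ('d f x v).
Proof. by move=> df dh; exact: (congr1 (fun k => k v) (diff_comp df dh)). Qed.

(** The chain rule read backwards: it evaluates the differential of a map that is
    only known to coincide near [x] with a composite. *)
Lemma diff_comp_near_eq (R : realType) (V W Z : normedModType R) (h : W -> Z) (f : V -> W)
    (g : V -> Z) x v : (\near x, h (f x) = g x) ->
  differentiable f x -> differentiable h (f x) ->
  'd h (f x) ('d f x v) = 'd g x v.
Proof.
move=> hfg df dh; apply: etrans (near_eq_diffE v hfg (differentiable_comp df dh)).
exact: (congr1 (fun k => k v) (esym (diff_comp df dh))).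
Qed.

Section Ck_theory.
Context {R : realType}.
Implicit Types V W Z : normedModType R.

Lemma Ck_sub V W k (U U' : set V) (f : V -> W) :
  U' `<=` U -> Ck k U f -> Ck k U' f.
Proof.
move=> U'U; elim: k f => [|k IHk] f /=; first by move=> cf x /U'U /cf.
by case=> df Cdf; split=> [x /U'U /df//|v]; exact/IHk/Cdf.
Qed.

Lemma Ck_eq V W k (U : set V) (f g : V -> W) : open U ->
  {in U, f =1 g} -> Ck k U f -> Ck k U g.
Proof.
move=> oU; elim: k f g => [|k IHk] f g /= fg.
  move=> cf x Ux; have fgx : \near x, f x = g x.
    by have := open_nbhs_nbhs (conj oU Ux); apply: filterS => y Uy; apply: fg; rewrite inE.
  apply: cvg_trans (near_eq_cvg fgx) _.
  by rewrite /= -(nbhs_singleton fgx); exact: cf.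
case=> df Cdf; have fgx x : U x -> \near x, f x = g x.
  move=> Ux; have := open_nbhs_nbhs (conj oU Ux).
  by apply: filterS => y Uy; apply: fg; rewrite inE.
split=> [x Ux|v]; first exact: near_eq_differentiable (fgx x Ux) (df x Ux).
apply: IHk (Cdf v) => x; rewrite inE => Ux.
by rewrite (near_eq_diff (fgx x Ux) (df x Ux)).
Qed.

Lemma CkW V W k (U : set V) (f : V -> W) : Ck k.+1 U f -> Ck k U f.
Proof.
elim: k f => [|k IHk] f [df Cdf].
  by move=> x /df; exact: differentiable_continuous.
by split=> // v; apply: IHk.
Qed.

Lemma Ck_cst V W k (U : set V) (a : W) : Ck k U (fun=> a : W).
Proof.
elim: k a => [|k IHk] a /=; first by move=> x _; exact: cst_continuous.
split=> [x _|v]; first exact: differentiable_cst.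
rewrite (_ : (fun _ => _) = fun=> 0)//.
by apply/funext => x; rewrite diff_cst.
Qed.

Lemma diff_cst_fun V W (a : W) (x v : V) : 'd (fun=> a) x v = 0.
Proof. exact: (congr1 (fun h => h v) (diff_cst a x)). Qed.

Lemma diff_id_fun V (x v : V) : 'd id x v = v.
Proof. by rewrite diff_val. Qed.

Lemma diffD_fun V W (f g : V -> W) x v : differentiable f x ->
  differentiable g x -> 'd (fun y => f y + g y) x v = 'd f x v + 'd g x v.
Proof. by move=> df dg; rewrite [LHS](congr1 (fun h => h v) (diffD df dg)). Qed.

Lemma CkD V W k (U : set V) (f g : V -> W) : open U ->
  Ck k U f -> Ck k U g -> Ck k U (fun x => f x + g x).
Proof.
move=> oU; elim: k f g => [|k IHk] f g /=.
  by move=> cf cg x Ux; apply: continuousD; [exact: cf|exact: cg].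
move=> [df Cf] [dg Cg]; split=> [x Ux|v].
  by apply: differentiableD; [exact: df|exact: dg].
apply: (Ck_eq oU _ (IHk _ _ (Cf v) (Cg v))) => x; rewrite inE => Ux.
by rewrite diffD_fun//; [exact: df|exact: dg].
Qed.

Lemma Ck_linear V W Z k (U : set V) (L : {linear W -> Z}) (f : V -> W) :
  open U -> continuous L -> Ck k U f -> Ck k U (L \o f).
Proof.
move=> oU cL; elim: k f => [|k IHk] f /=.
  by move=> cf x Ux; apply: continuous_comp; [exact: cf|exact: cL].
move=> [df Cf]; split=> [x Ux|v].
  by apply: differentiable_comp; [exact: df|exact: linear_differentiable].
apply: (Ck_eq oU _ (IHk _ (Cf v))) => x; rewrite inE => Ux.
rewrite (diff_comp (df x Ux)); last exact: linear_differentiable.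
by rewrite /= diff_lin.
Qed.

Lemma scale_is_bilinear W : bilinear_for
  (GRing.Scale.Law.clone _ _ *:%R _) (GRing.Scale.Law.clone _ _ *:%R _)
  ( *:%R : R -> W -> W).
Proof.
split=> [w|a] b x y /=; first by rewrite scalerDl scalerA.
by rewrite scalerDr !scalerA mulrC.
Qed.

HB.instance Definition _ W :=
  bilinear_isBilinear.Build R R W W _ _ ( *:%R : R -> W -> W)
    (@scale_is_bilinear W).

Let scale_pair_continuous W : continuous (fun p : R * W => p.1 *: p.2).
Proof.
exact: scale_continuous.
Qed.

Lemma is_diff_scale V W (c : V -> R) (f : V -> W) x :
  differentiable c x -> differentiable f x ->
  is_diff x (fun y => c y *: f y) (fun v => c x *: 'd f x v + 'd c x v *: f x).
Proof.
move=> dc df.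
pose B : R -> W -> W := *:%R.
have -> : (fun y => c y *: f y) = (fun p => p.1 *: p.2) \o (fun y => (c y, f y)).
  by [].
have dp := differentiable_pair dc df.
have dB := @differentiable_bilin _ _ _ _ B (c x, f x) (@scale_pair_continuous W).
apply: DiffDef; first exact: differentiable_comp.
rewrite diff_comp// (@diff_bilin _ _ _ _ B _ (@scale_pair_continuous W)).
by apply/funext => v /=; rewrite diff_pair.
Qed.

Lemma diffZ_fun V W (c : V -> R) (f : V -> W) x v : differentiable c x ->
  differentiable f x ->
  'd (fun y => c y *: f y) x v = c x *: 'd f x v + 'd c x v *: f x.
Proof.
by move=> dc df; rewrite [LHS](congr1 (fun h => h v)
  (diff_val (is_diff_def := is_diff_scale dc df))).
Qed.

Lemma CkZ V W k (U : set V) (c : V -> R) (f : V -> W) : open U ->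
  Ck k U c -> Ck k U f -> Ck k U (fun x => c x *: f x).
Proof.
move=> oU; elim: k c f => [|k IHk] c f.
  by move=> cc cf x Ux; apply: continuousZ; [exact: cc|exact: cf].
move=> Cc Cf; case: (Cc) (Cf) => dc Cdc [df Cdf]; split=> [x Ux|v].
  by have [] := is_diff_scale (dc x Ux) (df x Ux).
apply: (Ck_eq oU _ (CkD oU (IHk _ _ (CkW Cc) (Cdf v)) (IHk _ _ (Cdc v) (CkW Cf)))).
move=> x; rewrite inE => Ux.
by rewrite diffZ_fun//; [exact: dc|exact: df].
Qed.

Lemma Ck_sum V W k (U : set V) (I : Type) (r : seq I) (f : I -> V -> W) :
  open U -> (forall i, Ck k U (f i)) ->
  Ck k U (fun x => \sum_(i <- r) f i x).
Proof.
move=> oU Cf; elim: r => [|i r IHr].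
  by apply: (Ck_eq oU _ (Ck_cst k U 0)) => x _; rewrite big_nil.
by apply: (Ck_eq oU _ (CkD oU (Cf i) IHr)) => x _; rewrite big_cons.
Qed.

Lemma mx_linear_continuous W m n (L : {linear 'M[R]_(m, n) -> W}) :
  continuous L.
Proof.
have -> : (L : _ -> _) =
    (fun x => \sum_i \sum_j x i j *: L (delta_mx i j)) :> (_ -> _).
  apply/funext => x; rewrite [in LHS](matrix_sum_delta x) linear_sum.
  by apply: eq_bigr => i _; rewrite linear_sum; apply: eq_bigr => j _; rewrite linearZ.
apply: continuous_big => [|i _]; first exact: add_continuous.
apply: continuous_big => [|j _]; first exact: add_continuous.
move=> x; apply: (@continuousZr_tmp _ _ _ (fun y : 'M[R]_(m, n) => y i j)).
exact: coord_continuous.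
Qed.

Definition mx_entry m n i j (x : 'M[R]_(m, n)) : R := x i j.

Fact mx_entry_is_linear m n i j : linear (@mx_entry m n i j).
Proof. by move=> a x y; rewrite /mx_entry !mxE. Qed.
HB.instance Definition _ m n i j :=
  GRing.isLinear.Build R 'M[R]_(m, n) R *%R (@mx_entry m n i j)
    (@mx_entry_is_linear m n i j).

Lemma Ck_entry V m n k (U : set V) (f : V -> 'M[R]_(m, n)) i j : open U ->
  Ck k U f -> Ck k U (fun x => f x i j).
Proof.
by move=> oU; apply: (Ck_linear (L := @mx_entry m n i j)) => //; exact: coord_continuous.
Qed.

Lemma linear_row_sum W m (L : {linear 'rV[R]_m -> W}) v :
  L v = \sum_j v 0 j *: L (delta_mx 0 j).
Proof.
by rewrite [in LHS](row_sum_delta v) linear_sum; apply: eq_bigr => j _; rewrite linearZ.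
Qed.

(** The chain rule writes the derivative of g \o f in direction v as a sum over the
    coordinate directions of products of derivatives of [f] with partial
    derivatives of [g] composed with [f]; a finite-dimensional middle space makes
    the induction on the order of smoothness work. *)
Lemma Ck_comp V m Z k (U : set V) (U' : set 'rV[R]_m) (f : V -> 'rV[R]_m)
    (g : 'rV[R]_m -> Z) : open U -> open U' -> f @` U `<=` U' ->
  Ck k U f -> Ck k U' g -> Ck k U (g \o f).
Proof.
move=> oU oU' fU; have {}fU x : U x -> U' (f x) by move=> Ux; apply: fU; exists x.
elim: k g => [|k IHk] g.
  by move=> cf cg x Ux; apply: continuous_comp; [exact: cf|exact/cg/fU].
move=> Cf Cg; case: (Cf) (Cg) => df Cdf [dg Cdg]; split=> [x Ux|v].
  by apply: differentiable_comp; [exact: df|exact/dg/fU].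
pose D v x := \sum_j ('d f x v) 0 j *: 'd g (f x) (delta_mx 0 j).
apply: (@Ck_eq _ _ _ _ (D v)) => //.
  move=> x; rewrite inE => Ux; rewrite (diff_comp (df x Ux)) /=; last exact/dg/fU.
  by rewrite [RHS]linear_row_sum.
apply: Ck_sum => // j; apply: CkZ => //; first exact: (Ck_entry 0 j oU (Cdf v)).
exact: (IHk (fun y => 'd g y (delta_mx 0 j)) (CkW Cf) (Cdg _)).
Qed.

End Ck_theory.

Section Smooth_near_theory.
Context {R : realType}.
Implicit Types V W Z : normedModType R.

Lemma smooth_near_of_on V W (U : set V) (f : V -> W) x :
  open U -> U x -> smooth_on U f -> smooth_near f x.
Proof. by move=> oU Ux fU; exists U. Qed.

Lemma smooth_near_near V W (f : V -> W) x :
  smooth_near f x -> \forall y \near x, smooth_near f y.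
Proof.
case=> U [oU Ux] fU; apply: filterS (open_nbhs_nbhs (conj oU Ux)) => y Uy.
by exists U.
Qed.

Lemma smooth_near_differentiable V W (f : V -> W) x :
  smooth_near f x -> differentiable f x.
Proof. by case=> U [oU Ux] fU; have [/(_ x Ux)] := fU 1. Qed.

Lemma smooth_near_preimage V W (f : V -> W) x (P : W -> Prop) :
  smooth_near f x -> (\forall y \near f x, P y) -> \forall y \near x, P (f y).
Proof.
by move=> /smooth_near_differentiable/differentiable_continuous cf; exact: cf.
Qed.

Lemma smooth_near_eq V W (f g : V -> W) x :
  (\near x, f x = g x) -> smooth_near f x -> smooth_near g x.
Proof.
rewrite -nbhs_nearE nbhsE => -[U' [oU' U'x] fg] [U [oU Ux] fU].
exists (U' `&` U); first by split; [exact: openI|].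
move=> k; apply: (@Ck_eq _ _ _ _ _ f); first exact: openI.
  by move=> y; rewrite inE => -[/fg].
by apply: Ck_sub (fU k) => y [].
Qed.

Let smooth_near2 V W W' (f : V -> W) (g : V -> W') x :
  smooth_near f x -> smooth_near g x ->
  exists2 U, open_nbhs x U & forall k, Ck k U f /\ Ck k U g.
Proof.
case=> U [oU Ux] fU [U' [oU' U'x] gU']; exists (U `&` U').
  by split; [exact: openI|].
by move=> k; split; [apply: Ck_sub (fU k)|apply: Ck_sub (gU' k)] => y [].
Qed.

Lemma smooth_near_cst V W (a : W) (x : V) : smooth_near (fun=> a) x.
Proof.
by exists setT; [split; [exact: openT|]|move=> k; exact: Ck_cst].
Qed.

Lemma smooth_nearD V W (f g : V -> W) x : smooth_near f x ->
  smooth_near g x -> smooth_near (fun y => f y + g y) x.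
Proof.
move=> sf sg; have [U xU fgU] := smooth_near2 sf sg; exists U => // k.
by have [? ?] := fgU k; apply: CkD => //; case: xU.
Qed.

Lemma smooth_nearZ V W (c : V -> R) (f : V -> W) x : smooth_near c x ->
  smooth_near f x -> smooth_near (fun y => c y *: f y) x.
Proof.
move=> sf sg; have [U xU fgU] := smooth_near2 sf sg; exists U => // k.
by have [? ?] := fgU k; apply: CkZ => //; case: xU.
Qed.

Lemma smooth_near_sum V W (I : Type) (r : seq I) (f : I -> V -> W) x :
  (forall i, smooth_near (f i) x) ->
  smooth_near (fun y => \sum_(i <- r) f i y) x.
Proof.
move=> sf; elim: r => [|i r IHr].
  by rewrite (_ : (fun _ => _) = fun=> 0); [exact: smooth_near_cst|
    apply/funext => y; rewrite big_nil].
rewrite (_ : (fun _ => _) = fun y => f i y + \sum_(j <- r) f j y).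
  exact: smooth_nearD.
by apply/funext => y; rewrite big_cons.
Qed.

Lemma smooth_near_linear V W m n (L : {linear 'M[R]_(m, n) -> W})
    (f : V -> 'M[R]_(m, n)) x :
  smooth_near f x -> smooth_near (fun y => L (f y)) x.
Proof.
case=> U [oU Ux] fU; exists U => // k.
by apply: Ck_linear => //; exact: mx_linear_continuous.
Qed.

Lemma smooth_near_id m (x : 'rV[R]_m) : smooth_near id x.
Proof.
exists setT; first by split; [exact: openT|].
case=> [|k] /=; first by move=> y _; exact: cvg_id.
split=> [y _|v]; first exact: ex_diff.
rewrite (_ : (fun _ => _) = fun=> v); first exact: Ck_cst.
by apply/funext => y; rewrite diff_val.
Qed.

Lemma smooth_near_comp V m Z (f : V -> 'rV[R]_m) (g : 'rV[R]_m -> Z) x :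
  smooth_near f x -> smooth_near g (f x) -> smooth_near (fun y => g (f y)) x.
Proof.
move=> sf [U' [oU' U'x] gU'].
have [U [oU Ux] fU] := sf.
have oUf : open (U `&` f @^-1` U').
  rewrite openE => y [Uy U'fy]; apply: filterI; first exact: open_nbhs_nbhs.
  exact: (fU 0%N y Uy _ (open_nbhs_nbhs (conj oU' U'fy))).
exists (U `&` f @^-1` U') => // k; apply: (@Ck_comp _ _ _ _ _ _ U' f g) => //.
- by move=> _ [y [_ fy] <-].
- by apply: Ck_sub (fU k) => y [].
Qed.

Lemma smooth_near_entry V m n (f : V -> 'M[R]_(m, n)) i j x :
  smooth_near f x -> smooth_near (fun y => f y i j) x.
Proof. exact: (smooth_near_linear (@mx_entry R m n i j)). Qed.

Lemma smooth_near_mx V m n (f : V -> 'M[R]_(m, n)) x :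
  (forall i j, smooth_near (fun y => f y i j) x) -> smooth_near f x.
Proof.
move=> sf; rewrite (_ : f =
    fun y => \sum_i \sum_j f y i j *: delta_mx i j).
  apply: smooth_near_sum => i; apply: smooth_near_sum => j.
  by apply: smooth_nearZ => //; exact: smooth_near_cst.
by apply/funext => y; exact: matrix_sum_delta.
Qed.

Lemma smooth_near_mulmx V m n p (f : V -> 'M[R]_(m, n)) (g : V -> 'M[R]_(n, p))
    x : smooth_near f x -> smooth_near g x ->
  smooth_near (fun y => f y *m g y) x.
Proof.
move=> sf sg; apply: smooth_near_mx => i k.
rewrite (_ : (fun _ => _) = fun y => \sum_j f y i j *: (g y j k : R)).
  by apply: smooth_near_sum => j; apply: smooth_nearZ; exact: smooth_near_entry.
by apply/funext => y; rewrite mxE.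
Qed.

Lemma smooth_near_row_mx V m n1 n2 (f : V -> 'M[R]_(m, n1))
    (g : V -> 'M[R]_(m, n2)) x : smooth_near f x -> smooth_near g x ->
  smooth_near (fun y => row_mx (f y) (g y)) x.
Proof.
move=> sf sg; apply: smooth_near_mx => i j.
case: (split_ordP j) => k ->.
  rewrite (_ : (fun _ => _) = fun y => f y i k); first exact: smooth_near_entry.
  by apply/funext => y; rewrite row_mxEl.
rewrite (_ : (fun _ => _) = fun y => g y i k); first exact: smooth_near_entry.
by apply/funext => y; rewrite row_mxEr.
Qed.

Lemma smooth_near_col_mx V m1 m2 n (f : V -> 'M[R]_(m1, n))
    (g : V -> 'M[R]_(m2, n)) x : smooth_near f x -> smooth_near g x ->
  smooth_near (fun y => col_mx (f y) (g y)) x.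
Proof.
move=> sf sg; apply: smooth_near_mx => i j.
case: (split_ordP i) => k ->.
  rewrite (_ : (fun _ => _) = fun y => f y k j); first exact: smooth_near_entry.
  by apply/funext => y; rewrite col_mxEu.
rewrite (_ : (fun _ => _) = fun y => g y k j); first exact: smooth_near_entry.
by apply/funext => y; rewrite col_mxEd.
Qed.

Lemma smooth_near_diff V W (f : V -> W) v x :
  smooth_near f x -> smooth_near (fun y => 'd f y v) x.
Proof.
by case=> U [oU Ux] fU; exists U => // k; have [_ /(_ v)] := fU k.+1.
Qed.

Lemma smooth_near_diff_comp V m Z (f : 'rV[R]_m -> Z) (g h : V -> 'rV[R]_m) x :
  smooth_near f (g x) -> smooth_near g x -> smooth_near h x ->
  smooth_near (fun y => 'd f (g y) (h y)) x.
Proof.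
move=> sf sg sh.
rewrite (_ : (fun _ => _) =
    fun y => \sum_j h y 0 j *: 'd f (g y) (delta_mx 0 j)).
  apply: smooth_near_sum => j; apply: smooth_nearZ.
    exact: smooth_near_entry.
  by apply: (smooth_near_comp (g := fun z => 'd f z (delta_mx 0 j))) => //;
    exact: smooth_near_diff.
by apply/funext => y; exact: linear_row_sum.
Qed.

Lemma diff_linear W m n (L : {linear 'M[R]_(m, n) -> W}) x v : 'd L x v = L v.
Proof.
exact: (congr1 (fun h => h v) (diff_lin x (@mx_linear_continuous R W m n L))).
Qed.

Lemma diff_linear_comp V W m n (L : {linear 'M[R]_(m, n) -> W})
    (f : V -> 'M[R]_(m, n)) x v : differentiable f x ->
  'd (fun y => L (f y)) x v = L ('d f x v).
Proof.
move=> df; have cL := @mx_linear_continuous R W m n L.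
by rewrite (diff_comp (g := L) df (linear_differentiable (f x) cL)) /= diff_lin.
Qed.

Lemma diff_entry V m n (f : V -> 'M[R]_(m, n)) i j x v : differentiable f x ->
  'd (fun y => f y i j) x v = 'd f x v i j.
Proof. exact: (diff_linear_comp (@mx_entry R m n i j)). Qed.

Lemma diff_sum V W (I : Type) (r : seq I) (f : I -> V -> W) x v :
  (forall i, smooth_near (f i) x) ->
  'd (fun y => \sum_(i <- r) f i y) x v = \sum_(i <- r) 'd (f i) x v.
Proof.
move=> sf; elim: r => [|i r IHr].
  rewrite big_nil (_ : (fun _ => _) = fun=> 0) ?diff_cst//.
  by apply/funext => y; rewrite big_nil.
rewrite big_cons -IHr (_ : (fun _ => _) = fun y => f i y + \sum_(j <- r) f j y).
  rewrite diffD_fun//; apply: smooth_near_differentiable => //.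
  exact: smooth_near_sum.
by apply/funext => y; rewrite big_cons.
Qed.

Lemma diff_row_mx V m n1 n2 (f : V -> 'M[R]_(m, n1)) (g : V -> 'M[R]_(m, n2))
    x v : smooth_near f x -> smooth_near g x ->
  'd (fun y => row_mx (f y) (g y)) x v = row_mx ('d f x v) ('d g x v).
Proof.
move=> sf sg; have dfg := smooth_near_differentiable (smooth_near_row_mx sf sg).
rewrite -[LHS]hsubmxK; congr row_mx.
  apply: etrans (esym (diff_linear_comp (@lsubmx R m n1 n2) v dfg)) _.
  have -> // : (fun y => lsubmx (row_mx (f y) (g y))) = f.
  by apply/funext => y; rewrite row_mxKl.
apply: etrans (esym (diff_linear_comp (@rsubmx R m n1 n2) v dfg)) _.
have -> // : (fun y => rsubmx (row_mx (f y) (g y))) = g.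
by apply/funext => y; rewrite row_mxKr.
Qed.

(** The map y |-> df_y v is smooth for a fixed direction v only; expanding v in the
    standard basis is how a varying direction is handled. *)
Lemma diff_diff_sum m Z (f : 'rV[R]_m -> Z) x v w : smooth_near f x ->
  'd (fun y => 'd f y v) x w =
  \sum_j v 0 j *: 'd (fun y => 'd f y (delta_mx 0 j)) x w.
Proof.
move=> sf.
have sfj j : smooth_near (fun z => 'd f z (delta_mx 0 j)) x.
  exact: smooth_near_diff.
have -> : (fun y => 'd f y v) = fun y => \sum_j v 0 j *: 'd f y (delta_mx 0 j).
  by apply/funext => z; exact: linear_row_sum.
rewrite [LHS]diff_sum; last by move=> j; apply: smooth_nearZ => //; exact: smooth_near_cst.
apply: eq_bigr => j _.
have dj := smooth_near_differentiable (sfj j).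
apply: etrans (diffZ_fun (c := fun=> v 0 j) w (differentiable_cst _ _) dj) _.
rewrite [X in _ + X *: _]diff_cst_fun scale0r.
exact: addr0.
Qed.

(** Product rule for the bilinear pairing of the differential of f with a
    varying direction. *)
Lemma diff_diff_comp V m Z (f : 'rV[R]_m -> Z) (g h : V -> 'rV[R]_m) x v :
  smooth_near f (g x) -> smooth_near g x -> smooth_near h x ->
  'd (fun y => 'd f (g y) (h y)) x v =
  'd (fun z => 'd f z (h x)) (g x) ('d g x v) + 'd f (g x) ('d h x v).
Proof.
move=> sf sg sh.
have sfj j : smooth_near (fun z => 'd f z (delta_mx 0 j)) (g x).
  exact: smooth_near_diff.
have sfgj j : smooth_near (fun y => 'd f (g y) (delta_mx 0 j)) x.
  by apply: (smooth_near_comp (g := fun z => 'd f z (delta_mx 0 j))).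
have shj j : smooth_near (fun y => h y 0 j) x by exact: smooth_near_entry.
rewrite [X in _ = X + _](diff_diff_sum _ _ sf) [X in _ = _ + X]linear_row_sum.
rewrite -big_split.
have -> : (fun y => 'd f (g y) (h y)) =
    fun y => \sum_j h y 0 j *: 'd f (g y) (delta_mx 0 j).
  by apply/funext => y; exact: linear_row_sum.
rewrite [LHS]diff_sum; last by move=> j; exact: smooth_nearZ.
apply: eq_bigr => j _.
rewrite [LHS](diffZ_fun v (smooth_near_differentiable (shj j))
  (smooth_near_differentiable (sfgj j))).
rewrite [X in _ + X *: _](diff_entry 0 j v (smooth_near_differentiable sh)).
congr (_ *: _ + _).
exact: (diff_compE (h := fun z => 'd f z (delta_mx 0 j)) v
  (smooth_near_differentiable sg) (smooth_near_differentiable (sfj j))).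
Qed.

(** The quadratic form given by the second differential of f, at a base point g
    that is stationary in the direction v: as a quadratic form is differentiated
    in both of its slots, both orders of differentiation appear. *)
Lemma diff_diff_quadratic V m Z (f : 'rV[R]_m -> Z) (g h : V -> 'rV[R]_m) x v :
  smooth_near f (g x) -> smooth_near g x -> smooth_near h x -> 'd g x v = 0 ->
  'd (fun y => 'd (fun z => 'd f z (h y)) (g y) (h y)) x v =
  'd (fun z => 'd f z ('d h x v)) (g x) (h x) +
  'd (fun z => 'd f z (h x)) (g x) ('d h x v).
Proof.
move=> sf sg sh g0.
pose fj j z := 'd f z (delta_mx 0 j).
have sfj j : smooth_near (fj j) (g x) by exact: smooth_near_diff.
have sfgj j : smooth_near (fun y => 'd (fj j) (g y) (h y)) x.
  exact: smooth_near_diff_comp.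
have shj j : smooth_near (fun y => h y 0 j) x by exact: smooth_near_entry.
rewrite [X in _ = X + _](diff_diff_sum _ _ sf) [X in _ = _ + X](diff_diff_sum _ _ sf).
rewrite -big_split.
have E : \forall y \near x, \sum_j h y 0 j *: 'd (fj j) (g y) (h y) =
    'd (fun z => 'd f z (h y)) (g y) (h y).
  apply: filterS (smooth_near_preimage sg (smooth_near_near sf)) => y sfy.
  exact/esym/diff_diff_sum.
apply: etrans (esym (near_eq_diffE v E _)) _.
  apply: smooth_near_differentiable; apply: smooth_near_sum => j.
  exact: smooth_nearZ.
rewrite [LHS]diff_sum; last by move=> j; exact: smooth_nearZ.
apply: eq_bigr => j _.
rewrite [LHS](diffZ_fun v (smooth_near_differentiable (shj j))
  (smooth_near_differentiable (sfgj j))) addrC.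
congr (_ *: _ + _ *: _).
  exact: (diff_entry 0 j v (smooth_near_differentiable sh)).
apply: etrans (diff_diff_comp v (sfj j) sg sh) _.
have gv0 : 'd (fun z => 'd (fj j) z (h x)) (g x) ('d g x v) = 0.
  exact: etrans (congr1 ('d (fun z => 'd (fj j) z (h x)) (g x)) g0) (linear0 _).
exact: etrans (congr1 (fun a => a + _) gv0) (add0r _).
Qed.

End Smooth_near_theory.

Lemma smooth_on_of_near (R : realType) (V W : normedModType R) (U : set V)
    (f : V -> W) : (forall x, U x -> smooth_near f x) -> smooth_on U f.
Proof.
move=> sf k; elim: k f sf => [|k IHk] f sf /=.
  by move=> x /sf /smooth_near_differentiable /differentiable_continuous.
split=> [x /sf /smooth_near_differentiable//|v].
by apply: IHk => x /sf; exact: smooth_near_diff.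
Qed.

(** * Symmetry of second derivatives, and derivatives of curves *)

Section Second_differential.
Context {R : realType}.
Implicit Types V W : normedModType R.

Lemma is_diff_line V (a v : V) (s : R) :
  is_diff s (fun r => a + r *: v) ( *:%R ^~ v).
Proof.
have D : is_diff s (cst a + ( *:%R ^~ v)) (0 + ( *:%R ^~ v)) by exact: is_diffD.
by apply: is_diff_eq; rewrite add0r.
Qed.

Lemma is_derive_line V W (f : V -> W) (a v : V) (s : R) :
  differentiable f (a + s *: v) ->
  is_derive s 1 (fun r => f (a + r *: v)) ('d f (a + s *: v) v).
Proof.
move=> df; have [dl dlE] := is_diff_line a v s.
have dfl : differentiable (f \o (fun r => a + r *: v)) s.
  exact: differentiable_comp.
apply: DeriveDef; first exact/derivable1_diffP.
by rewrite deriveE// (diff_comp dl df) /= dlE scale1r.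
Qed.

Let mean_value (f f' : R -> R) (h : R) : 0 < h ->
  (forall s, 0 <= s <= h -> is_derive s 1 f (f' s)) ->
  exists2 s, 0 <= s <= h & f h - f 0 = f' s * h.
Proof.
move=> h0 df.
have [|||s] := @MVT_segment R f f' 0 h.
- exact: ltW.
- by move=> s /subset_itv_oo_cc; rewrite in_itv; exact: df.
- by apply: derivable_within_continuous => s; rewrite in_itv => /df ?; exact: ex_derive.
by rewrite in_itv subr0; exists s.
Qed.

(** The second difference of f over the parallelogram spanned by h v and h w, by
    the mean value theorem first along v and then along w. *)
Let square_mean_value V (f : V -> R) (U : set V) (x v w : V) (h : R) : 0 < h ->
  (forall s t : R, 0 <= s <= h -> 0 <= t <= h -> U (x + s *: v + t *: w)) ->
  Ck 2 U f -> exists s t, [/\ 0 <= s <= h, 0 <= t <= h &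
    f (x + h *: v + h *: w) - f (x + h *: v) - (f (x + h *: w) - f x) =
    'd (fun y => 'd f y v) (x + s *: v + t *: w) w * h * h].
Proof.
move=> h0 hU [df /(_ v)[dfv _]].
have h00 : (0 : R) <= 0 <= h by apply/andP; split=> //; exact: ltW.
have h0h : 0 <= h <= h by apply/andP; split=> //; exact: ltW.
have [||s sh] := @mean_value (fun s => f ((x + h *: w) + s *: v) - f (x + s *: v))
    (fun s => 'd f ((x + h *: w) + s *: v) v - 'd f (x + s *: v) v) h.
- by [].
- move=> s sh; apply: is_deriveB; apply: is_derive_line; apply: df.
    by rewrite addrAC; exact: hU.
  by rewrite -[_ + _]addr0 -(scale0r w); exact: hU.
have [||t th] := @mean_value (fun t => 'd f ((x + s *: v) + t *: w) v)
    (fun t => 'd (fun y => 'd f y v) ((x + s *: v) + t *: w) w) h.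
- by [].
- by move=> t th; apply: (is_derive_line (f := fun y => 'd f y v)); apply/dfv/hU.
rewrite !scale0r !addr0 => E2 E1; exists s, t; split=> //.
by rewrite -E2 [x + s *: v + h *: w]addrAC -E1 [x + h *: w + h *: v]addrAC.
Qed.

(** Symmetry of second derivatives: both iterated derivatives are limits of the
    same second difference of f over a small parallelogram. *)
Lemma diff_diffC V (f : V -> R) x v w : smooth_near f x ->
  'd (fun y => 'd f y v) x w = 'd (fun y => 'd f y w) x v.
Proof.
case=> U [oU Ux] fU; set A := LHS; set B := RHS.
apply/eqP; rewrite -subr_eq0 -normr_le0; apply/ler_addgt0Pr => e e0; rewrite add0r.
have nearAB : \forall y \near x,
   [/\ U y, `|A - 'd (fun y => 'd f y v) y w| < e / 2 &
     `|B - 'd (fun y => 'd f y w) y v| < e / 2].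
  have [_ /(_ v)[_ /(_ w) cA]] := fU 2.
  have [_ /(_ w)[_ /(_ v) cB]] := fU 2.
  have e2 : 0 < e / 2 by rewrite divr_gt0.
  move: (cA x Ux) (cB x Ux) => /cvgrPdist_lt/(_ _ e2) nA /cvgrPdist_lt/(_ _ e2) nB.
  near=> y; split; [|near: y; exact: nA|near: y; exact: nB].
  by near: y; exact: open_nbhs_nbhs.
(* A parallelogram small enough for both second derivatives to be close to their
   values at x. *)
have [d d0 hd] : exists2 d : R, 0 < d & forall s t, 0 <= s <= d -> 0 <= t <= d ->
   [/\ U (x + s *: v + t *: w),
     `|A - 'd (fun y => 'd f y v) (x + s *: v + t *: w) w| < e / 2 &
     `|B - 'd (fun y => 'd f y w) (x + s *: v + t *: w) v| < e / 2].
  have cl : (fun p : R * R => x + p.1 *: v + p.2 *: w) @ (0, 0) --> x.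
    rewrite -[X in _ --> X]addr0 -(scale0r w) -[X in _ --> X + _]addr0 -(scale0r v).
    apply: cvgD; last by apply: cvgZr_tmp; exact: cvg_snd.
    by apply: cvgD; [exact: cvg_cst|apply: cvgZr_tmp; exact: cvg_fst].
  have /nbhs_ballP[r /= r0 hr] := cl _ nearAB.
  exists (r / 2) => [|s t /andP[s0 sr] /andP[t0 tr]]; first by rewrite divr_gt0.
  apply: (hr (s, t)); split; rewrite /ball/= sub0r normrN ger0_norm//; lra.
have hU s t : 0 <= s <= d -> 0 <= t <= d -> U (x + s *: v + t *: w).
  by move=> sd td; have [] := hd s t sd td.
have hU' s t : 0 <= s <= d -> 0 <= t <= d -> U (x + s *: w + t *: v).
  by move=> sd td; rewrite addrAC; exact: hU.
have [s [t [sd td E1]]] := square_mean_value d0 hU (fU 2).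
have [s' [t' [sd' td' E2]]] := square_mean_value d0 hU' (fU 2).
have AB : 'd (fun y => 'd f y v) (x + s *: v + t *: w) w =
          'd (fun y => 'd f y w) (x + t' *: v + s' *: w) v.
  have dN0 : d != 0 by rewrite gt_eqF.
  apply: (mulIf dN0); apply: (mulIf dN0); rewrite -E1 addrAC [x + t' *: v + _]addrAC -E2.
  by rewrite [x + d *: w + d *: v]addrAC; ring.
have [_ hA _] := hd _ _ sd td; have [_ _ hB] := hd _ _ td' sd'.
rewrite -AB in hB; set z := 'd _ _ _ in hA hB.
rewrite (_ : A - B = (A - z) - (B - z)); last by ring.
by rewrite (le_trans (ler_normB _ _))//; lra.
Unshelve. all: by end_near. Qed.

Lemma diff_diffC_mx V m n (f : V -> 'M[R]_(m, n)) x v w : smooth_near f x ->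
  'd (fun y => 'd f y v) x w = 'd (fun y => 'd f y w) x v.
Proof.
move=> sf; apply/matrixP => i j.
have sfd u : smooth_near (fun y => 'd f y u) x by exact: smooth_near_diff.
have E u u' : 'd (fun y => 'd f y u) x u' i j =
    'd (fun y => 'd (fun z => f z i j) y u) x u'.
  rewrite -diff_entry; last exact: smooth_near_differentiable.
  rewrite (@near_eq_diff _ _ _ _ (fun y => 'd (fun z => f z i j) y u))//.
    have := smooth_near_near sf; apply: filterS => y sfy.
    by rewrite diff_entry//; exact: smooth_near_differentiable.
  exact/smooth_near_differentiable/smooth_near_entry.
by rewrite !E; apply: diff_diffC; exact: smooth_near_entry.
Qed.

End Second_differential.

Section Curves.
Context {R : realType}.
Implicit Types V W : normedModType R.

Lemma derive1_diff V (c : R -> V) t : smooth_near c t -> derive1 c t = 'd c t 1.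
Proof. by move=> sc; rewrite derive1E'//; exact: smooth_near_differentiable. Qed.

Lemma smooth_near_derive1 V (c : R -> V) t : smooth_near c t -> smooth_near (derive1 c) t.
Proof.
move=> sc; apply: (@smooth_near_eq _ _ _ (fun s => 'd c s 1)).
  by have := smooth_near_near sc; apply: filterS => s /derive1_diff.
exact: smooth_near_diff.
Qed.

Lemma derive1_comp_diff V W (c : R -> V) (f : V -> W) t :
  differentiable c t -> differentiable f (c t) ->
  derive1 (f \o c) t = 'd f (c t) (derive1 c t).
Proof.
move=> dc df; rewrite !derive1E' ?(diff_comp dc df)//.
exact: differentiable_comp.
Qed.

Lemma near_eq_derive1 V (c d : R -> V) t :
  (\near t, c t = d t) -> derive1 c t = derive1 d t.
Proof. by move=> cd; rewrite !derive1E; exact: near_eq_derive. Qed.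

Lemma smooth_near_line V (a v : V) (t r : R) :
  smooth_near (fun s : R => a + (s - r) *: v) t.
Proof.
apply: smooth_nearD; first exact: smooth_near_cst.
apply: smooth_nearZ; last exact: smooth_near_cst.
apply: smooth_nearD; last exact: smooth_near_cst.
exists setT; first by split; [exact: openT|].
case=> [|k] /=; first by move=> y _; exact: cvg_id.
split=> [y _|w]; first exact: ex_diff.
rewrite (_ : (fun _ => _) = fun=> w); first exact: Ck_cst.
by apply/funext => y; rewrite diff_val.
Qed.

Lemma derive1_line V (a v : V) (t r : R) :
  derive1 (fun s : R => a + (s - r) *: v) t = v.
Proof.
rewrite derive1_diff; last exact: smooth_near_line.
have -> : (fun s : R => a + (s - r) *: v) = fun s => (a - r *: v) + s *: v.
  by apply/funext => s; rewrite scalerBl addrA addrAC.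
apply: etrans (congr1 (fun h => h 1) (diff_val (is_diff_def := is_diff_line _ _ _))) _.
exact: scale1r.
Qed.

End Curves.

(** * Charts, tangent vectors and curves *)

Section Near_pt.
Context {R : realType} {n : nat} {T : Type} {A : atlas R n T} {p : T}.
Implicit Types P Q S : T -> Prop.

Lemma near_ptE P : (forall q, P q) -> near_pt A p P.
Proof. by move=> hP i ip; apply: filterE. Qed.

Lemma near_ptS P Q : (forall q, P q -> Q q) -> near_pt A p P -> near_pt A p Q.
Proof. by move=> PQ nP i ip; apply: filterS (nP i ip) => x Px q iq qx; exact/PQ/Px. Qed.

Lemma near_ptS2 P Q S : (forall q, P q -> Q q -> S q) ->
  near_pt A p P -> near_pt A p Q -> near_pt A p S.
Proof.
move=> PQS nP nQ i ip; apply: filterS2 (nP i ip) (nQ i ip) => x Px Qx q iq qx.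
by apply: PQS; [exact: Px|exact: Qx].
Qed.

End Near_pt.

Section Atlas_theory.
Context {R : realType} {n : nat} {T : Type} {A : atlas R n T}.
Hypothesis sA : smooth_atlas A.
Implicit Types (i j k : chart A) (p q : T).

Lemma rep_coord (V : choiceType) (v0 : V) i (f : T -> V) p :
  dom i p -> rep v0 i f (coord i p) = f p.
Proof.
move=> ip; apply: xget_unique; first by exists p.
move=> _ [q [iq qp] <-]; congr f.
by apply: (atlas_inj sA (i := i)) => //; rewrite inE.
Qed.

Lemma transition_coord i j p : dom i p -> transition i j (coord i p) = coord j p.
Proof. exact: rep_coord. Qed.

Lemma near_coord i p (P : 'rV[R]_n -> Prop) : dom i p ->
  near_pt A p (fun q => dom i q -> P (coord i q)) -> \forall x \near coord i p, P x.
Proof.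
move=> ip /(_ i ip) nP.
have ii : open_nbhs (coord i p) (coord i @` (dom i `&` dom i)).
  by split; [exact: atlas_open|exists p].
have := open_nbhs_nbhs ii; apply: filterS2 nP => x Px [q [iq _] qx].
by rewrite -qx; exact: Px.
Qed.

(** The condition of [near_pt] in all charts follows from a single chart, because
    transition maps are continuous. *)
Lemma near_pt_chart i p (P : T -> Prop) : dom i p ->
  (\forall x \near coord i p, forall q, dom i q -> coord i q = x -> P q) ->
  near_pt A p P.
Proof.
move=> ip nP j jp.
have ji : open_nbhs (coord j p) (coord j @` (dom j `&` dom i)).
  by split; [exact: atlas_open|exists p].
have cji : {for coord j p, continuous (transition j i)}.
  by apply: (atlas_smooth sA j i 0%N); exists p.
rewrite -(transition_coord i jp) in nP.
have {}nP : \forall x \near coord j p,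
    forall q, dom i q -> coord i q = transition j i x -> P q by exact: cji _ nP.
apply: filterS2 nP (open_nbhs_nbhs ji) => x Px [r [jr ir] rx] q jq qx.
have -> : q = r by apply: (atlas_inj sA (i := j)); rewrite ?inE// qx.
by apply: Px => //; rewrite -rx transition_coord.
Qed.

Lemma near_pt_self p P : near_pt A p P -> P p.
Proof. by have [i ip] := atlas_cover sA p; move=> /(_ i ip)/nbhs_singleton; exact. Qed.

Lemma near_pt_dom i p : dom i p -> near_pt A p (dom i).
Proof. by move=> ip; apply: (near_pt_chart ip); apply: filterE. Qed.

(** A formula [F] valid at the points near [p] is valid near [coord i p], as the
    image of a chart is open. *)
Lemma rep_near_eq (V : choiceType) (v0 : V) i (f : T -> V) (F : 'rV[R]_n -> V) p :
  dom i p -> near_pt A p (fun q => dom i q -> F (coord i q) = f q) ->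
  \forall x \near coord i p, F x = rep v0 i f x.
Proof.
move=> ip nF; apply: near_coord => //; apply: near_ptS nF => q + iq.
by rewrite rep_coord//; apply.
Qed.

Lemma transition_smooth i j p : dom i p -> dom j p ->
  smooth_near (transition i j) (coord i p).
Proof.
move=> ip jp; apply: (smooth_near_of_on _ _ (atlas_smooth sA i j)).
  exact: atlas_open.
by exists p.
Qed.

Lemma near_transition i j p (F : 'rV[R]_n -> 'rV[R]_n) : dom i p -> dom j p ->
  (forall q, dom i q -> dom j q -> coord j q = F (coord i q)) ->
  \forall x \near coord i p, transition i j x = F x.
Proof.
move=> ip jp FE; apply: near_coord => //.
by apply: near_ptS (near_pt_dom jp) => q jq iq; rewrite transition_coord// FE.
Qed.

Lemma transition_differentiable i j p : dom i p -> dom j p ->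
  differentiable (transition i j) (coord i p).
Proof. by move=> ip jp; exact/smooth_near_differentiable/transition_smooth. Qed.

Lemma diff_transition_comp i j k p v : dom i p -> dom j p -> dom k p ->
  'd (transition j k) (coord j p) ('d (transition i j) (coord i p) v) =
  'd (transition i k) (coord i p) v.
Proof.
move=> ip jp kp.
have dij := transition_differentiable ip jp.
have djk := transition_differentiable jp kp.
rewrite -(transition_coord j ip) in djk *.
apply: diff_comp_near_eq => //.
apply: near_coord => //; apply: near_ptS (near_pt_dom jp) => q jq iq.
by rewrite !transition_coord.
Qed.

Lemma diff_transition_id i p v : dom i p ->
  'd (transition i i) (coord i p) v = v.
Proof.
move=> ip; rewrite -[RHS](diff_id_fun (coord i p)).
apply/esym/near_eq_diffE; last exact: ex_diff.
by apply: near_coord => //; apply: near_ptE => q iq; rewrite transition_coord.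
Qed.

(** The tangent map of a change of coordinates determines the other components. *)
Lemma tangent_eq i p (v w : tvec A) : is_tangent p v -> is_tangent p w ->
  dom i p -> v i = w i -> v = w.
Proof.
move=> [v0 vT] [w0 wT] ip vw; apply/funext => j.
have [jp|jp] := pselect (dom j p); last by rewrite v0// w0.
by rewrite (vT i j ip jp) (wT i j ip jp) vw.
Qed.

Lemma is_tangent0 p : is_tangent p (0 : tvec A).
Proof. by split=> // i j _ _; rewrite linear0. Qed.

Lemma is_tangentD p (v w : tvec A) : is_tangent p v -> is_tangent p w ->
  is_tangent p (v + w).
Proof.
move=> [v0 vT] [w0 wT]; split=> [i ip|i j ip jp].
  by rewrite [LHS](_ : _ = v i + w i)// v0// w0// addr0.
by rewrite [LHS](_ : _ = v j + w j)// (vT i j)// (wT i j)// linearD.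
Qed.

Lemma is_tangentZ p a (v : tvec A) : is_tangent p v -> is_tangent p (a *: v).
Proof.
move=> [v0 vT]; split=> [i ip|i j ip jp].
  by rewrite [LHS](_ : _ = a *: v i)// v0// scaler0.
by rewrite [LHS](_ : _ = a *: v j)// (vT i j ip jp) -linearZ.
Qed.

Lemma is_tangent_sum p (I : Type) (r : seq I) (v : I -> tvec A) :
  (forall a, is_tangent p (v a)) -> is_tangent p (\sum_(a <- r) v a).
Proof.
by move=> vT; elim/big_ind: _ => //; [exact: is_tangent0|move=> *; exact: is_tangentD].
Qed.

Lemma tvec_sum (I : Type) (r : seq I) (v : I -> tvec A) i :
  (\sum_(a <- r) v a) i = \sum_(a <- r) v a i.
Proof. by elim/big_rec2: _ => // a x y _ <-. Qed.

Lemma chart_field_coord i x p : dom i p -> chart_field i x p i = x p.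
Proof.
by move=> ip; rewrite /chart_field (asboolT (conj ip ip)); exact: diff_transition_id.
Qed.

Lemma chart_field_tangent i x p : dom i p -> is_tangent p (chart_field i x p).
Proof.
move=> ip; split=> [j jp|j k jp kp]; rewrite /chart_field.
  by rewrite asboolF// => -[].
rewrite (asboolT (conj ip kp)) (asboolT (conj ip jp)).
exact/esym/diff_transition_comp.
Qed.

Lemma smooth_curve_chart i (c : R -> T) t : dom i (c t) ->
  (\forall s \near t, dom i (c s)) -> smooth_near (coord i \o c) t ->
  smooth_curve_at A c t.
Proof.
move=> ic nc sc j jc.
have nj : \forall s \near t, dom j (c s).
  by apply: filterS2 nc (smooth_near_preimage sc (near_pt_dom jc ic)) => s ds; exact.
split=> //; apply: (@smooth_near_eq _ _ _ (fun s => transition i j (coord i (c s)))).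
  by apply: filterS2 nc nj => s ds js; rewrite /= transition_coord.
by apply: (smooth_near_comp sc); exact: transition_smooth.
Qed.

Lemma smooth_curve_at_near (c : R -> T) t : smooth_curve_at A c t ->
  \forall s \near t, smooth_curve_at A c s.
Proof.
move=> sc; have [i ic] := atlas_cover sA (c t); have [nc si] := sc i ic.
apply: filterS2 (near_join nc) (smooth_near_near si) => s ncs sis.
by apply: (smooth_curve_chart (i := i)) => //; exact: nbhs_singleton ncs.
Qed.

(** As [T] is a bare type, the lift is built by choosing a preimage of each
    [gamma s] under the chart. It is smooth in every chart because the transition
    maps are. *)
Lemma lift_curve i p (gamma : R -> 'rV[R]_n) t : dom i p ->
  smooth_near gamma t -> gamma t = coord i p ->
  exists c : R -> T, [/\ c t = p,
    \forall s \near t, dom i (c s) /\ coord i (c s) = gamma s &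
    smooth_curve_at A c t].
Proof.
move=> ip sg gt.
pose c s := if pselect (exists q, dom i q /\ coord i q = gamma s) is left h
            then projT1 (cid h) else p.
have cP s q : dom i q -> coord i q = gamma s ->
    dom i (c s) /\ coord i (c s) = gamma s.
  move=> iq qs; rewrite /c; case: pselect => [h|[]]; last by exists q.
  by case: cid.
have ct : c t = p.
  have [ic ict] := cP t p ip (esym gt).
  by apply: (atlas_inj sA (i := i)); rewrite ?inE// ict.
have nc : \forall s \near t, dom i (c s) /\ coord i (c s) = gamma s.
  have ii : open_nbhs (gamma t) (coord i @` (dom i `&` dom i)).
    by rewrite gt; split; [exact: atlas_open|exists p].
  apply: filterS (smooth_near_preimage sg (open_nbhs_nbhs ii)) => s [q [iq _] qs].
  exact: cP iq qs.
exists c; split=> //; apply: (@smooth_curve_chart i); rewrite ?ct//.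
  by apply: filterS nc => s [].
by apply: smooth_near_eq sg; apply: filterS nc => s [_].
Qed.

Lemma curve_transition i j (c : R -> T) t : smooth_curve_at A c t ->
  dom i (c t) ->
  \forall s \near t, transition i j (coord i (c s)) = coord j (c s).
Proof.
move=> sc ic; apply: filterS (sc i ic).1 => s ds; exact: transition_coord.
Qed.

Lemma derive1_curve_transition i j (c : R -> T) t : smooth_curve_at A c t ->
  dom i (c t) -> dom j (c t) ->
  derive1 (coord j \o c) t =
  'd (transition i j) (coord i (c t)) (derive1 (coord i \o c) t).
Proof.
move=> sc ic jc; rewrite -(near_eq_derive1 (curve_transition j sc ic)).
rewrite -derive1_comp_diff//.
  exact: smooth_near_differentiable (sc i ic).2.
exact: transition_differentiable.
Qed.

Lemma velocity_tangent (c : R -> T) : smooth_curve_at A c 0 ->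
  is_tangent (c 0) (velocity (A := A) c).
Proof.
move=> sc; split=> [i ic|i j ic jc]; rewrite /velocity; first by rewrite asboolF.
by rewrite (asboolT ic) (asboolT jc); exact: derive1_curve_transition.
Qed.

Lemma rep_smooth_chart (W : normedModType R) i j (f : T -> W) p :
  dom i p -> dom j p -> smooth_near (rep 0 i f) (coord i p) ->
  smooth_near (rep 0 j f) (coord j p).
Proof.
move=> ip jp sf.
apply: (@smooth_near_eq _ _ _ (fun x => rep 0 i f (transition j i x))).
  apply: rep_near_eq => //; apply: near_ptS (near_pt_dom ip) => q iq jq.
  by rewrite transition_coord// rep_coord.
apply: smooth_near_comp; first exact: transition_smooth.
by rewrite transition_coord.
Qed.

(** The components in another chart are the image of those in chart [i] under the
    tangent map of the transition, which depends smoothly on the point. *)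
Lemma smooth_field_chart i (X : T -> tvec A) p : dom i p ->
  near_pt A p (fun q => is_tangent q (X q)) ->
  smooth_near (rep 0 i (fun q => X q i)) (coord i p) -> smooth_field_at X p.
Proof.
move=> ip Xt sX; split=> // j jp; apply: (rep_smooth_chart ip jp).
apply: (@smooth_near_eq _ _ _ (fun x =>
    'd (transition i j) x (rep 0 i (fun q => X q i) x))).
  apply: rep_near_eq => //; apply: near_ptS2 (near_pt_dom jp) Xt => q jq Xq iq.
  by rewrite rep_coord// -Xq.2.
apply: smooth_near_diff_comp => //; last exact: smooth_near_id.
exact: transition_smooth.
Qed.

End Atlas_theory.

Section Map_theory.
Context {R : realType} {m n : nat} {S T : Type}.
Context {A : atlas R m S} {B : atlas R n T}.
Hypotheses (sA : smooth_atlas A) (sB : smooth_atlas B).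

Lemma smooth_map_at_chart (f : S -> T) p (i : chart A) (j : chart B) :
  dom i p -> near_pt A p (fun q => dom j (f q)) ->
  smooth_near (rep 0 i (coord j \o f)) (coord i p) -> smooth_map_at A B f p.
Proof.
move=> ip nj sf k kp.
have jp : dom j (f p) := near_pt_self sA nj.
have nk : near_pt A p (fun q => dom k (f q)).
  apply: (near_pt_chart sA ip).
  have := near_pt_dom sB kp jp.
  rewrite -[coord j _](rep_coord sA 0 (coord j \o f) ip).
  move=> /(smooth_near_preimage sf).
  apply: filterS2 (nj i ip) => x jx kx q iq qx.
  apply: kx; first exact: (jx q).
  by rewrite -qx rep_coord.
split=> // i' ip'; apply: (rep_smooth_chart sA ip ip').
apply: (@smooth_near_eq _ _ _ (fun x => transition j k (rep 0 i (coord j \o f) x))).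
  apply: (rep_near_eq sA) => //; apply: near_ptS2 nj nk => q jq kq iq.
  by rewrite rep_coord//= transition_coord.
apply: smooth_near_comp => //; rewrite rep_coord//.
exact: transition_smooth.
Qed.

End Map_theory.

(** * The frame bundle *)

(** Transition maps are compared with explicit formulas [F]: [transition] itself is
    defined by a choice of points and carries no formula. *)
Lemma smooth_atlas_intro (R : realType) (n : nat) (T : Type) (A : atlas R n T)
    (F : chart A -> chart A -> 'rV[R]_n -> 'rV[R]_n) :
  (forall p, exists i : chart A, dom i p) ->
  (forall i : chart A, set_inj (dom i) (coord i)) ->
  (forall i j : chart A, open (coord i @` (dom i `&` dom j))) ->
  (forall (i j : chart A) p, dom i p -> dom j p ->
    coord j p = F i j (coord i p) /\ smooth_near (F i j) (coord i p)) ->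
  smooth_atlas A.
Proof.
move=> cA iA oA FA; split=> // i j; apply: smooth_on_of_near => _ [p [ip jp] <-].
have [_] := FA i j p ip jp; apply: smooth_near_eq.
have ij : open_nbhs (coord i p) (coord i @` (dom i `&` dom j)).
  by split; [exact: oA|exists p].
apply: filterS (open_nbhs_nbhs ij) => _ [q [iq jq] <-].
rewrite -(FA i j q iq jq).1; apply/esym/xget_unique; first by exists q.
move=> _ [r [ir rq] <-]; congr (coord j).
by apply: (iA i) => //; rewrite inE.
Qed.

Lemma det_continuous (R : realType) (n : nat) :
  continuous (fun B : 'M[R]_n => \det B).
Proof.
apply: continuous_big => [|s _]; first exact: add_continuous.
move=> B; apply: (@continuousM R _ (fun=> (-1) ^+ s)
  (fun C : 'M[R]_n => \prod_i C i (s i))); first exact: cst_continuous.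
apply: continuous_big => [|i _]; first exact: mul_continuous.
exact: coord_continuous.
Qed.

Lemma unitmx_open (R : realType) (n : nat) : open [set B : 'M[R]_n | B \in unitmx].
Proof.
rewrite (_ : mkset _ = (fun B : 'M[R]_n => \det B) @^-1` [set x | x != 0]).
  apply: open_comp; first by move=> B _; exact: det_continuous.
  exact: open_neq.
by apply/seteqP; split=> B; rewrite /= unitmxE unitfE.
Qed.

Section Frame_bundle.
Context {R : realType} {n : nat} {T : Type} {A : atlas R n T}.
Hypothesis sA : smooth_atlas A.
Implicit Types (i j : chart A) (p : T) (u : frame_bundle A).

Lemma frame_of_tangent u a : is_tangent (base u) (frame_of u a).
Proof. by have [+ _] := svalP u; apply. Qed.

Lemma frame_of_unit u i : dom i (base u) -> frame_matrix (frame_of u) i \in unitmx.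
Proof. by have [_ +] := svalP u; apply. Qed.

Lemma row_frame_matrix (X : 'I_n -> tvec A) i a : row a (frame_matrix X i) = X a i.
Proof. by apply/rowP => k; rewrite !mxE. Qed.

Lemma frame_bundle_eq u u' i : base u = base u' -> dom i (base u) ->
  frame_matrix (frame_of u) i = frame_matrix (frame_of u') i -> u = u'.
Proof.
move=> bu iu Xu; apply: eq_sig_hprop => [?|]; first exact: Prop_irrelevance.
have : frame_of u = frame_of u'.
  apply/funext => a; apply: (tangent_eq (frame_of_tangent u a) _ iu).
    by rewrite bu; exact: frame_of_tangent.
  by rewrite -!row_frame_matrix Xu.
by rewrite /base /frame_of in bu *; case: (sval u) bu => ? ?; case: (sval u') => ? ? /= -> ->.
Qed.

Lemma frame_matrix_transition p (X : 'I_n -> tvec A) i j :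
  (forall a, is_tangent p (X a)) -> dom i p -> dom j p ->
  frame_matrix X j =
  frame_matrix X i *m lin1_mx ('d (transition i j) (coord i p)).
Proof.
move=> Xt ip jp; apply/row_matrixP => a.
rewrite row_mul !row_frame_matrix mul_rV_lin1; exact: (Xt a).2.
Qed.

Lemma jacobian_unit p i j : dom i p -> dom j p ->
  lin1_mx ('d (transition i j) (coord i p)) \in unitmx.
Proof.
move=> ip jp.
have E : lin1_mx ('d (transition i j) (coord i p)) *m
    lin1_mx ('d (transition j i) (coord j p)) = 1%:M.
  apply/row_matrixP => a; rewrite rowE mulmxA !mul_rV_lin1 row1.
  apply: etrans (diff_transition_comp sA _ ip jp ip) _.
  exact: diff_transition_id.
exact: (mulmx1_unit E).1.
Qed.

(** Any invertible matrix gives a frame of vectors with constant components; the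
    matrix stays invertible in the other charts because jacobians are. *)
Lemma frame_with_matrix i p (B : 'M[R]_n) : dom i p -> B \in unitmx ->
  exists2 u : frame_bundle A, base u = p & frame_matrix (frame_of u) i = B.
Proof.
move=> ip uB; pose X a : tvec A := chart_field i (fun=> row a B) p.
have Xt a : is_tangent p (X a) by exact: chart_field_tangent.
have XB : frame_matrix X i = B.
  by apply/row_matrixP => a; rewrite row_frame_matrix /X chart_field_coord.
have fX : is_frame p X.
  split=> // j jp; rewrite (frame_matrix_transition Xt ip jp) XB.
  by rewrite unitmx_mul uB; exact: jacobian_unit.
by exists (exist _ (p, X) fX).
Qed.

Lemma frame_coord_image i j :
  @coord _ _ _ (frame_atlas A) i @` (dom (a := frame_atlas A) i `&`
    dom (a := frame_atlas A) j) =
  lsubmx @^-1` (coord i @` (dom i `&` dom j)) `&`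
  (vec_mx \o rsubmx) @^-1` [set B : 'M[R]_n | B \in unitmx].
Proof.
apply/seteqP; split=> [_ [u [iu ju] <-]|y [[p [ip jp] py] By]].
  split; first by exists (base u) => //=; rewrite row_mxKl.
  by rewrite /= row_mxKr mxvecK; exact: frame_of_unit.
have [u up uB] := frame_with_matrix ip By.
exists u; first by split; rewrite /= up.
by rewrite /= up py uB /= vec_mxK hsubmxK.
Qed.

Definition frame_transition i j (y : 'rV[R]_(n + n * n)) : 'rV[R]_(n + n * n) :=
  row_mx (transition i j (lsubmx y))
    (mxvec (vec_mx (rsubmx y) *m lin1_mx ('d (transition i j) (lsubmx y)))).

Lemma frame_transition_smooth i j p y : dom i p -> dom j p ->
  lsubmx y = coord i p -> smooth_near (frame_transition i j) y.
Proof.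
move=> ip jp yp.
have sl : smooth_near (@lsubmx R 1 n (n * n)) y.
  exact: (smooth_near_linear (@lsubmx R 1 n (n * n)) (smooth_near_id y)).
have sr : smooth_near (fun z => vec_mx (@rsubmx R 1 n (n * n) z)) y.
  exact: (smooth_near_linear (@vec_mx R n n)
    (smooth_near_linear (@rsubmx R 1 n (n * n)) (smooth_near_id y))).
have sij : smooth_near (transition i j) (lsubmx y).
  by rewrite yp; exact: transition_smooth.
apply: smooth_near_row_mx; first exact: smooth_near_comp.
apply: (smooth_near_linear (@mxvec R n n)); apply: smooth_near_mulmx => //.
apply: smooth_near_mx => a b.
rewrite (_ : (fun _ => _) = fun z =>
    ('d (transition i j) (lsubmx z) (delta_mx 0 a)) 0 b).
  apply/smooth_near_entry/smooth_near_diff_comp => //; exact: smooth_near_cst.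
by apply/funext => z; rewrite mxE.
Qed.

Lemma smooth_frame_atlas : smooth_atlas (frame_atlas A).
Proof.
apply: (smooth_atlas_intro (A := frame_atlas A) (F := frame_transition)) => [u|i u u'|i j|i j u iu ju].
- exact: (atlas_cover sA (base u)).
- rewrite !inE => iu iu' /eq_row_mx[cu /(can_inj mxvecK) Xu].
  apply: frame_bundle_eq Xu => //.
  by apply: (atlas_inj sA (i := i)) cu; rewrite inE.
- rewrite frame_coord_image; apply: openI; apply: open_comp.
  + by move=> y _; exact: continuous_lsubmx.
  + exact: atlas_open.
  + move=> y _; apply: (@mx_linear_continuous R _ 1 _
      (GRing.Linear.clone _ _ _ _ (@vec_mx R n n \o @rsubmx R 1 n (n * n)) _)).
  + exact: unitmx_open.
- split; last by apply: (frame_transition_smooth iu ju); rewrite /= row_mxKl.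
  rewrite /= /frame_transition row_mxKl row_mxKr mxvecK transition_coord//.
  congr (row_mx _ (mxvec _)).
  by apply: frame_matrix_transition => // a; exact: frame_of_tangent.
Qed.

(** The projection to the base commutes with the changes of coordinates, hence so
    does its tangent map. *)
Lemma base_part_tangent u (W : tvec (frame_atlas A)) : is_tangent u W ->
  is_tangent (base u) (base_part W).
Proof.
move=> [W0 WT]; split=> [i iu|i j iu ju]; rewrite /base_part.
  by rewrite W0// linear0.
rewrite (WT i j iu ju).
have sF := smooth_frame_atlas.
have dF := transition_differentiable sF iu ju.
pose L := @lsubmx R 1 n (n * n).
have Lu k u' : L (coord (a := frame_atlas A) k u') = coord (a := A) k (base u').
  by rewrite /L /= row_mxKl.
have dL : differentiable L (coord (a := frame_atlas A) i u).
  exact: differentiable_lsubmx.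
have dij : differentiable (transition i j) (L (coord (a := frame_atlas A) i u)).
  by rewrite Lu; exact: transition_differentiable.
have near_comm : \forall y \near coord (a := frame_atlas A) i u,
    transition i j (L y) = L (transition (A := frame_atlas A) i j y).
  apply: (near_coord sF) => //; apply: near_ptE => u' iu'.
  by rewrite (transition_coord sF)// !Lu transition_coord.
apply: etrans (esym (diff_linear_comp L (W i) dF)) _.
apply: etrans (esym (diff_comp_near_eq (W i) near_comm dL dij)) _.
have -> : L (coord (a := frame_atlas A) i u) = coord (a := A) i (base u) by [].
by congr ('d _ _ _); exact: diff_linear.
Qed.

End Frame_bundle.

(** * The manifold of 1-jets *)

Section Jet_theory.
Context {R : realType} {n : nat} {M : Type} {A : atlas R n M}.
Hypothesis sA : smooth_atlas A.
Implicit Types (i j : chart A) (p : M) (v w : 'rV[R]_n).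

Lemma same_jet_sym r a b : same_jet A r a b -> same_jet A r b a.
Proof. by case=> e1 e2 e3; split=> // i; rewrite -e2 => ia k kr; rewrite e3. Qed.

Lemma same_jet_trans r a b c : same_jet A r a b -> same_jet A r b c ->
  same_jet A r a c.
Proof.
case=> e1 e2 e3 [f1 f2 f3]; split; [by rewrite e1|by rewrite e2|].
by move=> i ia k kr; rewrite e3// f3// -e2.
Qed.

Lemma jet_curve_of r a (h : smooth_curve_at A a.2 a.1) :
  same_jet A r (jet_curve (jet_of r h)) a.
Proof.
rewrite /jet_curve; case: cid2 => b sb /= E.
by have : jet_class A r a a; [split|rewrite E => -[]].
Qed.

Lemma jet_eq r (J J' : jet A r) : same_jet A r (jet_curve J) (jet_curve J') ->
  J = J'.
Proof.
move=> JJ'; apply: eq_sig_hprop => [?|]; first exact: Prop_irrelevance.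
have svalE (K : jet A r) : sval K = jet_class A r (jet_curve K).
  by rewrite /jet_curve; case: cid2.
rewrite !svalE; apply/seteqP; split=> c [sc Jc]; split=> //.
  exact: same_jet_trans (same_jet_sym JJ') Jc.
exact: same_jet_trans JJ' Jc.
Qed.

Lemma jet_of_deriv r a (h : smooth_curve_at A a.2 a.1) i k : (k <= r)%N ->
  dom i (a.2 a.1) ->
  [/\ source (jet_of r h) = a.1, target (jet_of r h) = a.2 a.1 &
   jet_deriv (jet_of r h) i k = derive1n k (coord i \o a.2) a.1].
Proof.
move=> kr ia; have [e1 e2 e3] := jet_curve_of r h; split=> //.
by rewrite /jet_deriv e3// e2.
Qed.

(** The representative of a jet is chosen arbitrarily, so that the one of [p21 J]
    and the one of [J] need only agree to first order. *)
Lemma p21_same_jet (J : jet A 2) : same_jet A 1 (jet_curve (p21 J)) (jet_curve J).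
Proof. exact: jet_curve_of. Qed.

Lemma jet_deriv1_transition r (J : jet A r) i j :
  dom i (target J) -> dom j (target J) ->
  jet_deriv J j 1 =
  'd (transition i j) (coord i (target J)) (jet_deriv J i 1).
Proof.
move=> iJ jJ; have E := derive1_curve_transition sA (jet_curveP (J := J)) iJ jJ.
exact: E.
Qed.

(** Second-order chain rule: the acceleration of a curve transforms with an
    additional term, quadratic in the velocity. *)
Lemma jet_deriv2_transition r (J : jet A r) i j :
  dom i (target J) -> dom j (target J) ->
  jet_deriv J j 2 =
  'd (fun x => 'd (transition i j) x (jet_deriv J i 1)) (coord i (target J))
     (jet_deriv J i 1) +
  'd (transition i j) (coord i (target J)) (jet_deriv J i 2).
Proof.
move=> iJ jJ; have sc := jet_curveP (J := J).
rewrite /jet_deriv /target in iJ jJ *.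
set c := (jet_curve J).2 in sc iJ jJ *; set t := (jet_curve J).1 in sc iJ jJ *.
have [ni si] := sc i iJ; have sgij := transition_smooth sA iJ jJ.
have sd := smooth_near_derive1 si.
have E : \forall s \near t, derive1 (coord j \o c) s =
    'd (transition i j) ((coord i \o c) s) (derive1 (coord i \o c) s).
  near=> s; apply: (derive1_curve_transition sA); last 2 first.
  - by near: s.
  - by near: s; exact: (sc j jJ).1.
  - by near: s; exact: smooth_curve_at_near.
apply: etrans (near_eq_derive1 E) _.
rewrite [LHS]derive1_diff; last exact: smooth_near_diff_comp.
apply: etrans (diff_diff_comp _ sgij si sd) _.
exact: (f_equal2 (fun a b =>
  'd (fun x => 'd (transition i j) x (derive1 (coord i \o c) t)) (coord i (c t)) a +
  'd (transition i j) (coord i (c t)) b)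
  (esym (derive1_diff si)) (esym (derive1_diff sd))).
Unshelve. all: by end_near. Qed.

(** By the chain rule, 1-jets with the same coordinates in one chart have the same
    derivatives in all charts. *)
Lemma jet1_coord_inj (J J' : jet A 1) i :
  dom i (target J) -> dom i (target J') -> source J = source J' ->
  coord i (target J) = coord i (target J') ->
  jet_deriv J i 1 = jet_deriv J' i 1 -> J = J'.
Proof.
move=> iJ iJ' st ct dt.
have tt : target J = target J' by apply: (atlas_inj sA (i := i)); rewrite ?inE.
apply: jet_eq; split; [exact: st|exact: tt|move=> j jJ [_|[_|k kr]]]; last first.
- discriminate kr.
- have jJ' : dom j (target J') by rewrite -tt.
  have E := jet_deriv1_transition iJ' jJ'; rewrite -dt -ct in E.
  exact: etrans (jet_deriv1_transition iJ jJ) (esym E).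
exact: (congr1 (coord j) tt).
Qed.

(** Realised by a curve that is affine in the chart. *)
Lemma jet1_exists i p (t : R) v : dom i p ->
  exists J : jet A 1, [/\ source J = t, target J = p & jet_deriv J i 1 = v].
Proof.
move=> ip; pose gamma (s : R) := coord i p + (s - t) *: v.
have sg : smooth_near gamma t by exact: smooth_near_line.
have gt : gamma t = coord i p by rewrite /gamma subrr scale0r addr0.
have [c [ct cg sc]] := lift_curve sA ip sg gt.
have ic : dom i (c t) by rewrite ct.
have [eJ1 eJ2 eJ3] := @jet_of_deriv 1 (t, c) sc i 1 isT ic.
exists (@jet_of _ _ _ A 1 (t, c) sc).
split; [exact: eJ1|exact: etrans eJ2 ct|apply: etrans eJ3 _].
apply: etrans _ (derive1_line (coord i p) v t t).
by apply: near_eq_derive1; apply: filterS cg => s [].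
Qed.

(** The components x and x' of a triple of coordinates (t, x, x'). *)
Definition jet_pos (y : 'rV[R]_(1 + (n + n))) : 'rV[R]_n := lsubmx (rsubmx y).
Definition jet_vel (y : 'rV[R]_(1 + (n + n))) : 'rV[R]_n := rsubmx (rsubmx y).

Fact jet_pos_is_linear : linear jet_pos.
Proof. by move=> a x y; rewrite /jet_pos !linearP. Qed.
HB.instance Definition _ := GRing.isLinear.Build R _ _ _ jet_pos jet_pos_is_linear.

Fact jet_vel_is_linear : linear jet_vel.
Proof. by move=> a x y; rewrite /jet_vel !linearP. Qed.
HB.instance Definition _ := GRing.isLinear.Build R _ _ _ jet_vel jet_vel_is_linear.

Lemma jet_pos_row t v w : jet_pos (row_mx t (row_mx v w)) = v.
Proof. by rewrite /jet_pos row_mxKr row_mxKl. Qed.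

Lemma jet_vel_row t v w : jet_vel (row_mx t (row_mx v w)) = w.
Proof. by rewrite /jet_vel !row_mxKr. Qed.

Lemma jet_coordK (y : 'rV[R]_(1 + (n + n))) :
  row_mx (lsubmx y) (row_mx (jet_pos y) (jet_vel y)) = y.
Proof. by rewrite /jet_pos /jet_vel !hsubmxK. Qed.

Lemma jet_pos_smooth y : smooth_near jet_pos y.
Proof. exact: (smooth_near_linear jet_pos (smooth_near_id y)). Qed.

Lemma jet_vel_smooth y : smooth_near jet_vel y.
Proof. exact: (smooth_near_linear jet_vel (smooth_near_id y)). Qed.

Definition jet_transition i j (y : 'rV[R]_(1 + (n + n))) : 'rV[R]_(1 + (n + n)) :=
  row_mx (lsubmx y) (row_mx (transition i j (jet_pos y))
                            ('d (transition i j) (jet_pos y) (jet_vel y))).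

Lemma coord1_transition i j (J : jet A 1) : dom i (target J) ->
  dom j (target J) -> coord1 j J = jet_transition i j (coord1 i J).
Proof.
move=> iJ jJ; rewrite /jet_transition /coord1 /= jet_pos_row jet_vel_row row_mxKl.
congr (row_mx _ (row_mx _ _)); first by rewrite transition_coord.
exact: jet_deriv1_transition.
Qed.

Lemma jet_transition_smooth i j (J : jet A 1) y : dom i (target J) ->
  dom j (target J) -> jet_pos y = coord i (target J) ->
  smooth_near (jet_transition i j) y.
Proof.
move=> iJ jJ yJ; have sij : smooth_near (transition i j) (jet_pos y).
  by rewrite yJ; exact: transition_smooth.
apply: smooth_near_row_mx.
  exact: (smooth_near_linear (@lsubmx R 1 1 (n + n)) (smooth_near_id y)).
apply: smooth_near_row_mx; first exact: (smooth_near_comp (jet_pos_smooth y) sij).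
apply: (smooth_near_diff_comp sij); [exact: jet_pos_smooth|exact: jet_vel_smooth].
Qed.

Lemma smooth_atlas1 : smooth_atlas (atlas1 A).
Proof.
apply: (smooth_atlas_intro (A := atlas1 A) (F := jet_transition)) => [J|i J J'|i j|i j J iJ jJ].
- exact: (atlas_cover sA (target J)).
- rewrite !inE => iJ iJ' /eq_row_mx[st /eq_row_mx[ct dt]].
  apply: jet1_coord_inj ct dt => //.
  by move/rowP/(_ 0): st; rewrite !mxE.
- rewrite (_ : _ @` _ = jet_pos @^-1` (coord (a := A) i @` (dom (a := A) i `&` dom (a := A) j))).
    apply: open_comp; last exact: atlas_open.
    by move=> y _; exact/differentiable_continuous/smooth_near_differentiable/jet_pos_smooth.
  apply/seteqP; split=> [_ [J [iJ jJ] <-]|y [p [ip jp] py]].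
    by exists (target J); rewrite //= jet_pos_row.
  have [J [sJ tJ dJ]] := jet1_exists (lsubmx y 0 0) (jet_vel y) ip.
  exists J; first by split; rewrite /= tJ.
  rewrite /= sJ tJ py dJ -[RHS]jet_coordK; congr row_mx.
  by apply/rowP => k; rewrite !mxE !ord1.
- split; first exact: coord1_transition.
  by apply: (jet_transition_smooth iJ jJ); rewrite /= jet_pos_row.
Qed.

(** Tangent map of the prolonged change of coordinates
    (t, x, x') |-> (t, f x, df_x x'). *)
Lemma diff_jet_transition i j (J : jet A 1) b v w :
  dom i (target J) -> dom j (target J) ->
  'd (transition (A := atlas1 A) i j) (coord1 i J) (row_mx b (row_mx v w)) =
  row_mx b (row_mx ('d (transition i j) (coord i (target J)) v)
    ('d (fun x => 'd (transition i j) x (jet_deriv J i 1)) (coord i (target J)) v +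
     'd (transition i j) (coord i (target J)) w)).
Proof.
move=> iJ jJ; set y := coord1 i J.
have yJ : jet_pos y = coord i (target J) by rewrite /y /coord1 /= jet_pos_row.
have sij : smooth_near (transition i j) (jet_pos y).
  by rewrite yJ; exact: transition_smooth.
have dE := near_eq_diffE (row_mx b (row_mx v w))
  (near_transition smooth_atlas1 iJ jJ (F := jet_transition i j)
     (fun q iq jq => coord1_transition iq jq))
  (transition_differentiable smooth_atlas1 iJ jJ).
apply: etrans dE _; rewrite -/(coord1 i J) -/y.
have sl : smooth_near (@lsubmx R 1 1 (n + n)) y.
  exact: (smooth_near_linear (@lsubmx R 1 1 (n + n)) (smooth_near_id y)).
have sx : smooth_near (fun z => transition i j (jet_pos z)) y.
  exact: (smooth_near_comp (jet_pos_smooth y) sij).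
have sv : smooth_near (fun z => 'd (transition i j) (jet_pos z) (jet_vel z)) y.
  exact: (smooth_near_diff_comp sij (jet_pos_smooth y) (jet_vel_smooth y)).
apply: etrans (diff_row_mx _ sl (smooth_near_row_mx sx sv)) _.
congr row_mx.
  exact: etrans (diff_linear (@lsubmx R 1 1 (n + n)) _ _) (row_mxKl _ _).
apply: etrans (diff_row_mx _ sx sv) _.
have dpos : 'd jet_pos y (row_mx b (row_mx v w)) = v.
  exact: etrans (diff_linear jet_pos _ _) (jet_pos_row _ _ _).
have dvel : 'd jet_vel y (row_mx b (row_mx v w)) = w.
  exact: etrans (diff_linear jet_vel _ _) (jet_vel_row _ _ _).
have yv : jet_vel y = jet_deriv J i 1 by rewrite /y /coord1 /= jet_vel_row.
congr row_mx.
  apply: etrans (diff_compE _ (smooth_near_differentiable (jet_pos_smooth y))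
    (smooth_near_differentiable sij)) _; rewrite yJ.
  exact: (congr1 ('d (transition i j) (coord i (target J))) dpos).
apply: etrans (diff_diff_comp _ sij (jet_pos_smooth y) (jet_vel_smooth y)) _.
rewrite yJ yv; exact: (f_equal2 (fun a c =>
  'd (fun x => 'd (transition i j) x (jet_deriv J i 1)) (coord i (target J)) a +
  'd (transition i j) (coord i (target J)) c) dpos dvel).
Qed.

Definition fibre_vector v : 'rV[R]_(1 + (n + n)) := row_mx 0 (row_mx 0 v).

(** Changes of induced coordinates act on vertical vectors as on the vectors of the
    base, which is why [epsilon] does not depend on the chart. *)
Lemma diff_jet_transition_fibre i j (J : jet A 1) v :
  dom i (target J) -> dom j (target J) ->
  'd (transition (A := atlas1 A) i j) (coord1 i J) (fibre_vector v) =
  fibre_vector ('d (transition i j) (coord i (target J)) v).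
Proof.
move=> iJ jJ; apply: etrans (diff_jet_transition 0 0 v iJ jJ) _.
have d0 : 'd (transition i j) (coord i (target J)) 0 = 0 by exact: linear0.
have b0 : 'd (fun x => 'd (transition i j) x (jet_deriv J i 1))
    (coord i (target J)) 0 = 0 by exact: linear0.
apply: etrans (f_equal2 (fun a b => row_mx 0 (row_mx a (b + _))) d0 b0) _.
exact: (congr1 (fun w => row_mx 0 (row_mx 0 w)) (add0r _)).
Qed.

End Jet_theory.

(** * Vertical vectors, the field X^sigma and horizontal lifts *)

Section Vertical_vectors.
Context {R : realType} {n : nat} {M : Type} {A : atlas R n M}.
Hypothesis sA : smooth_atlas A.

Lemma epsilon_tangent (J : jet A 1) (v : tvec A) :
  is_tangent (target J) v -> is_tangent J (epsilon v).
Proof.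
move=> [v0 vT]; split=> [i iJ|i j iJ jJ]; rewrite /epsilon.
  by rewrite v0// !row_mx0.
apply: etrans _ (esym (diff_jet_transition_fibre sA (v i) iJ jJ)).
exact: (congr1 (@fibre_vector R n) (vT i j iJ jJ)).
Qed.

Lemma epsilon_vertical (J : jet A 1) (v : tvec A) : is_tangent (target J) v ->
  vertical (A := atlas1 A) (atlas0 A) (@p10 _ _ _ A) J (epsilon v).
Proof.
move=> vT; split; first exact: epsilon_tangent.
move=> i j iJ jJ; have s1 := smooth_atlas1 sA; set y := coord i J.
have yJ : jet_pos y = coord (a := A) i (target J) by rewrite /y /= jet_pos_row.
have sij : smooth_near (transition (A := A) i j) (jet_pos y).
  by rewrite yJ; exact: transition_smooth.
have sl : smooth_near (@lsubmx R 1 1 (n + n)) y.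
  exact: (smooth_near_linear (@lsubmx R 1 1 (n + n)) (smooth_near_id y)).
have sx : smooth_near (fun z => transition (A := A) i j (jet_pos z)) y.
  exact: (smooth_near_comp (jet_pos_smooth y) sij).
pose F z := row_mx (@lsubmx R 1 1 (n + n) z) (transition (A := A) i j (jet_pos z)).
have FE : \forall z \near y, F z =
    rep 0 i (coord (a := atlas0 A) j \o (@p10 _ _ _ A)) z.
  apply: (rep_near_eq s1) => //.
  apply: (near_ptS _ (near_pt_dom s1 (i := j) jJ)) => K jK iK.
  rewrite /F /= row_mxKl jet_pos_row; congr row_mx.
  exact: transition_coord.
have dF := smooth_near_differentiable (smooth_near_row_mx sl sx).
apply: etrans (esym (near_eq_diffE _ FE dF)) _.
apply: etrans (diff_row_mx _ sl sx) _; rewrite -[RHS]row_mx0; congr row_mx.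
  exact: etrans (diff_linear (@lsubmx R 1 1 (n + n)) _ _) (row_mxKl _ _).
apply: etrans (diff_compE _ (smooth_near_differentiable (jet_pos_smooth y))
    (smooth_near_differentiable sij)) _.
apply: etrans _ (linear0 ('d (transition (A := A) i j) (jet_pos y))).
apply: (congr1 ('d (transition (A := A) i j) (jet_pos y))).
exact: etrans (diff_linear (@jet_pos R n) _ _) (jet_pos_row _ _ _).
Qed.

End Vertical_vectors.

Section SODE_theory.
Context {R : realType} {n : nat} {M : Type} {A : atlas R n M}.
Context {sigma : jet A 1 -> jet A 2}.
Hypotheses (sA : smooth_atlas A) (hsigma : SODE sigma).
Implicit Types (i j : chart A) (xi : jet A 1) (v w : 'rV[R]_n).

(** The representatives chosen for [sigma xi] and for [xi] are unrelated; that sigma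
    is a section of p21 says that they agree to first order. *)
Lemma sode_jet xi : [/\ source (sigma xi) = source xi,
  target (sigma xi) = target xi & forall i, dom i (target xi) ->
  jet_deriv (sigma xi) i 1 = jet_deriv xi i 1].
Proof.
have := p21_same_jet (sigma xi); rewrite hsigma.2 => -[e1 e2 e3].
split; [exact: esym e1|exact: esym e2|].
by move=> i ix; exact: (esym (e3 i ix 1%N isT)).
Qed.

Lemma accelerationE i xi : acceleration sigma i xi = jet_deriv (sigma xi) i 2.
Proof. by rewrite /acceleration /= !row_mxKr. Qed.

Lemma acceleration_transition i j xi : dom i (target xi) -> dom j (target xi) ->
  acceleration sigma j xi =
  'd (fun x => 'd (transition i j) x (jet_deriv xi i 1)) (coord i (target xi))
     (jet_deriv xi i 1) +
  'd (transition i j) (coord i (target xi)) (acceleration sigma i xi).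
Proof.
have [_ tE dE] := sode_jet xi; rewrite -tE => iJ jJ.
rewrite !accelerationE -[jet_deriv xi i 1]dE; last by rewrite -tE.
exact: jet_deriv2_transition.
Qed.

Lemma Fcoord_coord i xi : dom i (target xi) ->
  Fcoord sigma i (coord1 i xi) = acceleration sigma i xi.
Proof. by move=> ix; exact: (rep_coord (smooth_atlas1 sA) 0 (acceleration sigma i)). Qed.

Lemma Fcoord_smooth i xi : dom i (target xi) ->
  smooth_near (Fcoord sigma i) (coord1 i xi).
Proof.
move=> ix; have s1 := smooth_atlas1 sA; have [_ tE _] := sode_jet xi.
have isx : dom (a := atlas2 A) i (sigma xi) by rewrite /= tE.
have [_ /(_ i ix) sF] := hsigma.1 xi i isx.
have := smooth_near_linear (@rsubmx R 1 n n) (smooth_near_linear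
  (@rsubmx R 1 n (n + n)) (smooth_near_linear (@rsubmx R 1 1 (n + (n + n))) sF)).
apply: smooth_near_eq; apply: (rep_near_eq s1) => //.
by apply: near_ptE => K iK; rewrite rep_coord.
Qed.

(** The second-order chain rule, as an identity between functions of the
    coordinates (t, x, x'), so that it can be differentiated. *)
Lemma Fcoord_transition i j xi : dom i (target xi) -> dom j (target xi) ->
  \forall y \near coord1 i xi, Fcoord sigma j (jet_transition i j y) =
    'd (fun x => 'd (transition i j) x (jet_vel y)) (jet_pos y) (jet_vel y) +
    'd (transition i j) (jet_pos y) (Fcoord sigma i y).
Proof.
move=> ix jx; have s1 := smooth_atlas1 sA.
apply: (near_coord s1 (i := i)) => //.
apply: near_ptS (near_pt_dom s1 (i := j) jx) => K jK iK.
rewrite -/(coord1 i K) -coord1_transition// !Fcoord_coord//.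
have -> : jet_pos (coord1 i K) = coord i (target K) by rewrite /coord1 /= jet_pos_row.
have -> : jet_vel (coord1 i K) = jet_deriv K i 1 by rewrite /coord1 /= jet_vel_row.
exact: acceleration_transition.
Qed.

(** Derivative of the transformation law of F along the fibres; the two
    derivatives of its quadratic term agree by symmetry of second derivatives. *)
Lemma diff_Fcoord_transition i j xi v :
  dom i (target xi) -> dom j (target xi) ->
  'd (Fcoord sigma j) (coord1 j xi)
     (fibre_vector ('d (transition i j) (coord i (target xi)) v)) =
  'd (fun x => 'd (transition i j) x (jet_deriv xi i 1)) (coord i (target xi)) v *+ 2
  + 'd (transition i j) (coord i (target xi))
       ('d (Fcoord sigma i) (coord1 i xi) (fibre_vector v)).
Proof.
move=> ix jx; have s1 := smooth_atlas1 sA; set y := coord1 i xi.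
have yx : jet_pos y = coord i (target xi) by rewrite /y /coord1 /= jet_pos_row.
have yv : jet_vel y = jet_deriv xi i 1 by rewrite /y /coord1 /= jet_vel_row.
have yT : coord1 j xi = jet_transition i j y by exact: coord1_transition.
have sij : smooth_near (transition i j) (jet_pos y).
  by rewrite yx; exact: transition_smooth.
have sT : smooth_near (jet_transition i j) y.
  exact: (jet_transition_smooth sA ix jx).
have sFj : smooth_near (Fcoord sigma j) (jet_transition i j y).
  by rewrite -yT; exact: Fcoord_smooth.
have sFi : smooth_near (Fcoord sigma i) y by exact: Fcoord_smooth.
have sp := jet_pos_smooth y; have sv := jet_vel_smooth y.
have dp : 'd (@jet_pos R n) y (fibre_vector v) = 0.
  exact: etrans (diff_linear (@jet_pos R n) _ _) (jet_pos_row _ _ _).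
have dv : 'd (@jet_vel R n) y (fibre_vector v) = v.
  exact: etrans (diff_linear (@jet_vel R n) _ _) (jet_vel_row _ _ _).
have dT : 'd (jet_transition i j) y (fibre_vector v) =
    fibre_vector ('d (transition i j) (coord i (target xi)) v).
  apply: etrans (esym (near_eq_diffE _ (near_transition s1 ix jx
    (fun q iq jq => coord1_transition sA iq jq))
    (transition_differentiable s1 ix jx))) _.
  exact: diff_jet_transition_fibre.
rewrite -dT yT.
apply: etrans (diff_comp_near_eq (fibre_vector v) (Fcoord_transition ix jx)
  (smooth_near_differentiable sT) (smooth_near_differentiable sFj)) _.
have sQ : smooth_near (fun z => 'd (fun x => 'd (transition i j) x (jet_vel z))
    (jet_pos z) (jet_vel z)) y.
  pose fk k x := 'd (transition i j) x (delta_mx 0 k).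
  have sfk k : smooth_near (fk k) (jet_pos y) by exact: smooth_near_diff.
  apply: (@smooth_near_eq _ _ _ (fun z => \sum_k jet_vel z 0 k *:
      'd (fk k) (jet_pos z) (jet_vel z))).
    apply: filterS (smooth_near_preimage sp (smooth_near_near sij)) => z sz.
    exact: (esym (diff_diff_sum _ _ sz)).
  apply: smooth_near_sum => k; apply: smooth_nearZ.
    exact: smooth_near_entry.
  exact: smooth_near_diff_comp.
have sD := smooth_near_diff_comp sij sp sFi.
apply: etrans (diffD_fun _ (smooth_near_differentiable sQ)
  (smooth_near_differentiable sD)) _.
congr (_ + _).
  apply: etrans (diff_diff_quadratic sij sp sv dp) _.
  rewrite yv dv yx.
  rewrite [X in X + _]diff_diffC_mx; last by rewrite -yx.
  by rewrite mulr2n.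
apply: etrans (diff_diff_comp _ sij sp sFi) _; rewrite yx.
have d0 : 'd (fun z => 'd (transition i j) z (Fcoord sigma i y))
    (coord i (target xi)) ('d (@jet_pos R n) y (fibre_vector v)) = 0.
  exact: etrans (congr1 ('d (fun z => 'd (transition i j) z (Fcoord sigma i y))
    (coord i (target xi))) dp) (linear0 _).
exact: etrans (congr1 (fun a => a + _) d0) (add0r _).
Qed.

Lemma Xsigma_tangent xi : is_tangent xi (Xsigma sigma xi).
Proof.
split=> [i ix|i j ix jx]; rewrite /Xsigma; first by rewrite asboolF.
rewrite (asboolT ix) (asboolT jx) /Xsigma_coord.
apply: etrans _ (esym (diff_jet_transition sA _ _ _ ix jx)).
congr (row_mx _ (row_mx _ _)); first exact: jet_deriv1_transition.
exact: acceleration_transition.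
Qed.

Lemma dFE i k l xi : dom i (target xi) -> dF sigma i k l xi =
  'd (Fcoord sigma i) (coord1 i xi) (fibre_vector (delta_mx 0 k)) 0 l.
Proof.
by move=> ix; rewrite /dF deriveE//; exact/smooth_near_differentiable/Fcoord_smooth.
Qed.

Lemma Hsigma_spatial_coord i xi (v : tvec A) : dom i (target xi) ->
  Hsigma sigma xi (spatial v) i = \sum_k v i 0 k *: Xh_coord sigma i k xi.
Proof.
move=> ix; rewrite /Hsigma (asboolT ix) /spatial row_mxKl row_mxKr mxE scale0r add0r.
by apply: eq_bigr => k _; rewrite mulr0 subr0.
Qed.

Lemma sum_Xh_coord i xi v : dom i (target xi) ->
  \sum_k v 0 k *: Xh_coord sigma i k xi = row_mx 0 (row_mx v
    (2^-1 *: 'd (Fcoord sigma i) (coord1 i xi) (fibre_vector v))).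
Proof.
move=> ix.
pose B : 'M[R]_(n, 1 + (n + n)) := row_mx 0 (row_mx 0 1%:M).
have vB w : fibre_vector w = w *m B.
  by rewrite /B !mul_mx_row !mulmx0 mulmx1.
have FB w : 'd (Fcoord sigma i) (coord1 i xi) (fibre_vector w) =
    w *m (B *m lin1_mx ('d (Fcoord sigma i) (coord1 i xi))).
  by rewrite mulmxA -vB mul_rV_lin1.
rewrite FB -[LHS]/(\sum_k v 0 k *: _).
rewrite (_ : row_mx 0 _ = v *m row_mx 0 (row_mx 1%:M (2^-1 *:
    (B *m lin1_mx ('d (Fcoord sigma i) (coord1 i xi)))))); last first.
  by rewrite !mul_mx_row mulmx0 mulmx1 scalemxAr.
rewrite mulmx_sum_row; apply: eq_bigr => k _; congr (_ *: _).
rewrite /Xh_coord rowE !mul_mx_row mulmx0 mulmx1 -scalemxAr -FB.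
by congr (row_mx _ (row_mx _ (_ *: _))); apply/rowP => l; rewrite mxE dFE.
Qed.

(** The second differential of the change of coordinates enters the tangent map of
    the change of induced coordinates once, and the fibre derivative of F twice;
    the factor 1/2 makes both agree. *)
Lemma Hsigma_spatial_tangent xi (v : tvec A) : is_tangent (target xi) v ->
  is_tangent xi (Hsigma sigma xi (spatial v)).
Proof.
move=> [v0 vT]; split=> [i ix|i j ix jx]; first by rewrite /Hsigma asboolF.
have HE k (kx : dom (a := A) k (target xi)) :=
  etrans (Hsigma_spatial_coord v kx) (sum_Xh_coord (v k) kx).
apply: etrans (HE j jx) _; rewrite (HE i ix).
apply: etrans _ (esym (diff_jet_transition sA _ _ _ ix jx)).
congr row_mx; congr row_mx; first exact: vT.
rewrite (vT i j ix jx) [X in _ *: X = _](diff_Fcoord_transition (v i) ix jx).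
have two_neq0 : (2 : R) != 0 by rewrite pnatr_eq0.
rewrite scalerDr -[X in _ *: X + _]scaler_nat scalerA (mulVf two_neq0) scale1r.
congr (_ + _); apply/esym; exact: linearZ.
Qed.

End SODE_theory.

(** * The G-structure of adapted frames *)

Section Frame_blocks.
Context {R : realType} {n : nat}.
Implicit Types (c : R) (L : 'M[R]_n) (P : 'M[R]_(1 + (n + n))).

(** The elements of the group G for c = 1 and L invertible, and those of its Lie
    algebra for c = 0. *)
Definition frame_block c L : 'M[R]_(1 + (n + n)) :=
  block_mx c%:M 0 0 (block_mx L 0 0 L).

Lemma frame_blockM c c' L L' :
  frame_block c L *m frame_block c' L' = frame_block (c * c') (L *m L').
Proof.
by rewrite /frame_block !mulmx_block !mulmx0 !mul0mx !addr0 !add0r scalar_mxM.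
Qed.

Lemma frame_block1 : frame_block 1 1%:M = 1%:M.
Proof. by rewrite /frame_block -!scalar_mx_block. Qed.

Lemma trmx_frame_block c L : (frame_block c L)^T = frame_block c L^T.
Proof. by rewrite /frame_block !tr_block_mx !trmx0 tr_scalar_mx. Qed.

Lemma frame_block_linear a c c' L L' :
  a *: frame_block c L + frame_block c' L' = frame_block (a * c + c') (a *: L + L').
Proof.
by rewrite /frame_block !scale_block_mx !add_block_mx !scaler0 !addr0
  scale_scalar_mx -raddfD.
Qed.

Lemma frame_block_unit L : frame_block 1 L \in unitmx -> L \in unitmx.
Proof.
by rewrite !unitmxE /frame_block !det_ublock det_scalar1 mul1r unitrM => /andP[].
Qed.

Lemma frame_index_ind (Q : 'I_(1 + (n + n)) -> Prop) : Q X0_index ->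
  (forall k, Q (Xh_index k)) -> (forall k, Q (Xv_index k)) -> forall a, Q a.
Proof.
move=> Q0 Qh Qv a; case: (split_ordP a) => [k ->|b ->]; first by rewrite ord1; exact: Q0.
by case: (split_ordP b) => k ->; [exact: Qh|exact: Qv].
Qed.

Lemma sum_frame_index (V : zmodType) (f : 'I_(1 + (n + n)) -> V) :
  \sum_a f a = f X0_index + (\sum_k f (Xh_index k) + \sum_k f (Xv_index k)).
Proof. by rewrite !big_split_ord big_ord1. Qed.

Let row_mul_sum P' P a : row a (P' *m P) = \sum_b P' a b *: row b P.
Proof. by rewrite row_mul mulmx_sum_row; apply: eq_bigr => b _; rewrite mxE. Qed.

Lemma row0_frame_block c L P :
  row X0_index (frame_block c L *m P) = c *: row X0_index P.
Proof.
rewrite row_mul_sum sum_frame_index /X0_index /Xh_index /Xv_index /frame_block.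
rewrite block_mxEul mxE eqxx mulr1n !big1 ?addr0// => k _;
  by rewrite block_mxEur mxE scale0r.
Qed.

Lemma rowh_frame_block c L P k : row (Xh_index k) (frame_block c L *m P) =
  \sum_l L k l *: row (Xh_index l) P.
Proof.
rewrite row_mul_sum sum_frame_index /X0_index /Xh_index /Xv_index /frame_block.
rewrite block_mxEdl mxE scale0r add0r [X in _ + X]big1 ?addr0 => [|l _].
  by apply: eq_bigr => l _; rewrite block_mxEdr block_mxEul.
by rewrite block_mxEdr block_mxEur mxE scale0r.
Qed.

Lemma rowv_frame_block c L P k : row (Xv_index k) (frame_block c L *m P) =
  \sum_l L k l *: row (Xv_index l) P.
Proof.
rewrite row_mul_sum sum_frame_index /X0_index /Xh_index /Xv_index /frame_block.
rewrite block_mxEdl mxE scale0r add0r [X in X + _]big1 ?add0r => [|l _].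
  by apply: eq_bigr => l _; rewrite !block_mxEdr.
by rewrite block_mxEdr block_mxEdl mxE scale0r.
Qed.

End Frame_blocks.

Lemma fibre_vector_sum (R : realType) n (v : 'rV[R]_n) :
  fibre_vector v = \sum_k v 0 k *: ddx1 k.
Proof.
rewrite /fibre_vector (_ : row_mx 0 _ = v *m row_mx 0 (row_mx 0 1%:M)).
  rewrite mulmx_sum_row; apply: eq_bigr => k _.
  by rewrite !row_row_mx !row0 row1.
by rewrite !mul_mx_row !mulmx0 mulmx1.
Qed.

Section Adapted_frames.
Context {R : realType} {n : nat} {M : Type} {A : atlas R n M}.
Context {sigma : jet A 1 -> jet A 2}.
Hypotheses (sA : smooth_atlas A) (hsigma : SODE sigma).
Implicit Types (i j : chart A) (xi : jet A 1) (u : frame_bundle (atlas1 A)).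
Let s1 := smooth_atlas1 sA.

Definition fibre_jacobian i (y : 'rV[R]_(1 + (n + n))) : 'M[R]_n :=
  \matrix_k 'd (Fcoord sigma i) y (fibre_vector (delta_mx 0 k)).

(** The rows are the components, in the i-th induced chart, of the adapted frame
    X^sigma, X^sigma_k, d/dx'^k at the point with coordinates y. *)
Definition adapted_mx i (y : 'rV[R]_(1 + (n + n))) : 'M[R]_(1 + (n + n)) :=
  block_mx 1 (row_mx (jet_vel y) (Fcoord sigma i y))
           0 (block_mx 1%:M (2^-1 *: fibre_jacobian i y) 0 1%:M).

Lemma adapted_mx_unit i y : adapted_mx i y \in unitmx.
Proof. by rewrite unitmxE !det_ublock !det1 !mulr1 unitr1. Qed.

Lemma row0_adapted_mx i xi : dom i (target xi) ->
  row X0_index (adapted_mx i (coord1 i xi)) = Xsigma_coord sigma i xi.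
Proof.
move=> ix; rewrite /adapted_mx /block_mx /X0_index rowKu row_id /Xsigma_coord.
by rewrite (Fcoord_coord sA ix) /coord1 /= jet_vel_row.
Qed.

Lemma rowh_adapted_mx i xi k : dom i (target xi) ->
  row (Xh_index k) (adapted_mx i (coord1 i xi)) = Xh_coord sigma i k xi.
Proof.
move=> ix; rewrite /adapted_mx /block_mx /Xh_index rowKd row_row_mx row0 rowKu.
rewrite row_row_mx row1 linearZ /= rowK; congr (row_mx _ (row_mx _ (_ *: _))).
by apply/rowP => l; rewrite mxE (dFE sA hsigma).
Qed.

Lemma rowv_adapted_mx i y k : row (Xv_index k) (adapted_mx i y) = ddx1 k.
Proof.
by rewrite /adapted_mx /block_mx /Xv_index rowKd row_row_mx row0 rowKd row_row_mx row0 row1.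
Qed.

Lemma adapted_mx_smooth i xi : dom i (target xi) ->
  smooth_near (adapted_mx i) (coord1 i xi).
Proof.
move=> ix; have sF := Fcoord_smooth sA hsigma ix.
rewrite /adapted_mx /block_mx; apply: smooth_near_col_mx; apply: smooth_near_row_mx.
- exact: smooth_near_cst.
- by apply: smooth_near_row_mx => //; exact: jet_vel_smooth.
- exact: smooth_near_cst.
apply: smooth_near_col_mx; apply: smooth_near_row_mx; try exact: smooth_near_cst.
apply: smooth_nearZ; first exact: smooth_near_cst.
apply: smooth_near_mx => a b.
rewrite (_ : (fun _ => _) = fun y =>
    ('d (Fcoord sigma i) y (fibre_vector (delta_mx 0 a))) 0 b).
  by apply: smooth_near_entry; exact: smooth_near_diff.
by apply/funext => y; rewrite mxE.
Qed.

(** The row [k] of [L] holds the components of the vector [v] of the base with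
    epsilon v = X_(n + k). Conversely the vectors obtained from [L] are adapted since
    X^sigma, [epsilon] and [Hsigma] give tangent vectors, which can be compared in
    the chart [i] alone. *)
Lemma adapted_framesP i u : dom i (target (base u)) ->
  adapted_frames sigma u <-> exists L : 'M[R]_n,
    frame_matrix (frame_of u) i =
    frame_block 1 L *m adapted_mx i (coord1 i (base u)).
Proof.
move=> iu; split=> [[u0 uk]|[L uL]].
  exists (\matrix_k jet_vel (frame_of u (Xv_index k) i)).
  apply/row_matrixP; apply: frame_index_ind => [|k|k]; rewrite row_frame_matrix.
  - rewrite row0_frame_block scale1r row0_adapted_mx// u0 /Xsigma.
    by rewrite (asboolT iu).
  - have [_ [v [vT uv uh]]] := uk k; rewrite rowh_frame_block uh.
    rewrite Hsigma_spatial_coord//; apply: eq_bigr => l _.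
    by rewrite rowh_adapted_mx// mxE uv /epsilon jet_vel_row.
  - have [_ [v [vT uv uh]]] := uk k; rewrite rowv_frame_block uv.
    rewrite -[LHS]/(fibre_vector (v i)) fibre_vector_sum; apply: eq_bigr => l _.
    by rewrite rowv_adapted_mx mxE uv /epsilon jet_vel_row.
have rowE a : frame_of u a i =
    row a (frame_block 1 L *m adapted_mx i (coord1 i (base u))).
  by rewrite -uL row_frame_matrix.
have iu1 : dom (a := atlas1 A) i (base u) by [].
split=> [|k].
  apply: (tangent_eq (frame_of_tangent u _) (Xsigma_tangent sA hsigma _) iu1).
  by rewrite rowE row0_frame_block scale1r row0_adapted_mx// /Xsigma (asboolT iu).
pose v : tvec A := chart_field i (fun=> row k L) (target (base u)).
have vT : is_tangent (target (base u)) v by exact: chart_field_tangent.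
have vi : v i = row k L by rewrite /v chart_field_coord.
have uv : frame_of u (Xv_index k) = epsilon v.
  apply: (tangent_eq (frame_of_tangent u _) (epsilon_tangent sA vT) iu1).
  rewrite rowE rowv_frame_block -[RHS]/(fibre_vector (v i)) fibre_vector_sum.
  by apply: eq_bigr => l _; rewrite rowv_adapted_mx vi mxE.
split; first by rewrite uv; exact: epsilon_vertical.
exists v; split=> //.
apply: (tangent_eq (frame_of_tangent u _) (Hsigma_spatial_tangent sA hsigma vT)
  iu1).
rewrite rowE rowh_frame_block Hsigma_spatial_coord//.
by apply: eq_bigr => l _; rewrite rowh_adapted_mx// vi mxE.
Qed.

Lemma frame_act_matrix (X : 'I_(1 + (n + n)) -> tvec (atlas1 A)) g i :
  frame_matrix (frame_act X g) i = g^T *m frame_matrix X i.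
Proof.
apply/matrixP => a k; rewrite !mxE /frame_act tvec_sum summxE.
by apply: eq_bigr => b _; rewrite !mxE.
Qed.

(** Since (X g)_b = X_a g^a_b, the matrix of components of X g is that of X
    multiplied on the left by the transpose of [g]. *)
Lemma adapted_orbit u u' : base u = base u' -> adapted_frames sigma u ->
  (adapted_frames sigma u' <-> exists2 g, adapted_group R n g &
     frame_of u' = frame_act (frame_of u) g).
Proof.
move=> bu uQ; have [i iu] := atlas_cover sA (target (base u)).
have iu' : dom i (target (base u')) by rewrite -bu.
have iu1' : dom (a := atlas1 A) i (base u') by [].
have [L uL] := (adapted_framesP iu).1 uQ.
have unit_of (w : frame_bundle (atlas1 A)) K : dom i (target (base w)) ->
    frame_matrix (frame_of w) i = frame_block 1 K *m adapted_mx i (coord1 i (base w)) ->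
    K \in unitmx.
  move=> iw wK; apply: frame_block_unit.
  have := frame_of_unit (u := w) (i := i) iw.
  by rewrite wK unitmx_mul => /andP[].
split=> [/(adapted_framesP iu')[L' uL']|[g [K uK gK] ug]].
  have LU := unit_of u L iu uL; have LU' := unit_of u' L' iu' uL'.
  exists (frame_block 1 (L' *m invmx L))^T.
    rewrite trmx_frame_block; exists (L' *m invmx L)^T => //.
    by rewrite unitmx_tr unitmx_mul LU' unitmx_inv.
  apply/funext => a.
  apply: (tangent_eq (p := base u') (frame_of_tangent u' a) _ iu1').
    rewrite -bu; apply: is_tangent_sum => b; apply: is_tangentZ.
    exact: frame_of_tangent.
  rewrite -!row_frame_matrix; congr (row a _).
  have LL : frame_block 1 (L' *m invmx L) *m frame_block 1 L = frame_block 1 L'.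
    by rewrite frame_blockM mulr1 (mulmxKV LU).
  rewrite frame_act_matrix trmxK uL uL' mulmxA LL bu.
  reflexivity.
apply/(adapted_framesP iu'); exists (K^T *m L).
have KL : g^T *m frame_block 1 L = frame_block 1 (K^T *m L).
  by rewrite gK [X in X *m _](trmx_frame_block 1 K) frame_blockM mulr1.
rewrite ug frame_act_matrix uL mulmxA KL bu.
reflexivity.
Qed.

Lemma adapted_section xi : exists s : jet A 1 -> frame_bundle (atlas1 A),
  near_pt (atlas1 A) xi (fun q => base (s q) = q /\ adapted_frames sigma (s q)) /\
  smooth_map_at (atlas1 A) (frame_atlas (atlas1 A)) s xi.
Proof.
have [i ix] : exists i : chart A, dom (a := atlas1 A) i xi := atlas_cover s1 xi.
have ex q : dom (a := atlas1 A) i q -> exists u : frame_bundle (atlas1 A),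
    base u = q /\ frame_matrix (frame_of u) i = adapted_mx i (coord1 i q).
  move=> iq; have [u uq uM] := frame_with_matrix s1 iq
    (adapted_mx_unit i (coord1 i q)).
  by exists u.
(* Outside the domain of the chart, any frame will do. *)
pose s q := if pselect (dom (a := atlas1 A) i q) is left iq then projT1 (cid (ex q iq))
            else projT1 (cid (ex xi ix)).
have sP q : dom (a := atlas1 A) i q ->
    base (s q) = q /\ frame_matrix (frame_of (s q)) i = adapted_mx i (coord1 i q).
  by move=> iq; rewrite /s; case: pselect => // iq'; case: cid.
exists s; split.
  apply: near_ptS (near_pt_dom s1 ix) => q iq; have [bq sq] := sP q iq.
  split=> //; apply/(adapted_framesP (i := i)); first by rewrite bq.
  by exists 1%:M; rewrite frame_block1 mul1mx bq.
have sb q : dom (a := atlas1 A) i q -> dom (a := atlas1 A) i (base (s q)) by move=> iq; rewrite (sP q iq).1.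
apply: (smooth_map_at_chart s1 (smooth_frame_atlas s1) (i := i) (j := i)) => //.
  exact: near_ptS sb (near_pt_dom s1 ix).
pose F (y : 'rV[R]_(1 + (n + n))) := row_mx y (mxvec (adapted_mx i y)).
apply: (@smooth_near_eq _ _ _ F).
  apply: (rep_near_eq s1) => //; apply: near_ptE => q iq /=.
  by have [-> ->] := sP q iq.
apply: smooth_near_row_mx; first exact: smooth_near_id.
exact: (smooth_near_linear (@mxvec R _ _) (adapted_mx_smooth ix)).
Qed.

Lemma adapted_G_structure : G_structure (adapted_group R n) (adapted_frames sigma).
Proof. by split; [exact: adapted_orbit|exact: adapted_section]. Qed.

End Adapted_frames.

(** * Covariant derivatives in coordinates *)

Section Connection_theory.
Context {R : realType} {n : nat} {T : Type} {A : atlas R n T}.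
Context {nabla : covariant_derivative A}.
Hypotheses (sA : smooth_atlas A) (cN : linear_connection nabla).
Implicit Types (i j : chart A) (p q : T) (v w : tvec A) (X Y : T -> tvec A).

Lemma smooth_fun_cst c p : smooth_fun_at A (fun=> c) p.
Proof.
move=> i ip; apply: (@smooth_near_eq _ _ _ (fun=> c)).
  by apply: (rep_near_eq sA) => //; exact: near_ptE.
exact: smooth_near_cst.
Qed.

Lemma smooth_field_chart_field i (x : T -> 'rV[R]_n) p : dom i p ->
  smooth_near (rep 0 i x) (coord i p) -> smooth_field_at (chart_field i x) p.
Proof.
move=> ip sx; apply: (smooth_field_chart sA ip).
  by apply: near_ptS (near_pt_dom sA ip) => q iq; exact: chart_field_tangent.
apply: smooth_near_eq sx; apply: (rep_near_eq sA) => //; apply: near_ptE => q iq.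
by rewrite rep_coord// chart_field_coord.
Qed.

Lemma rep_cst i p (a : 'rV[R]_n) : dom i p ->
  \forall x \near coord i p, a = rep 0 i (fun=> a) x.
Proof. by move=> ip; apply: (rep_near_eq sA) => //; exact: near_ptE. Qed.

Lemma smooth_field_cst i (a : 'rV[R]_n) p : dom i p ->
  smooth_field_at (chart_field i (fun=> a)) p.
Proof.
move=> ip; apply: smooth_field_chart_field => //.
by apply: smooth_near_eq (rep_cst a ip) _; exact: smooth_near_cst.
Qed.

Lemma smooth_fieldZ (f : T -> R) X p : smooth_fun_at A f p ->
  smooth_field_at X p -> smooth_field_at (fun q => f q *: X q) p.
Proof.
move=> sf [Xt sX]; split=> [|i ip].
  by apply: near_ptS Xt => q; exact: is_tangentZ.
apply: smooth_near_eq (smooth_nearZ (sf i ip) (sX i ip)).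
apply: (rep_near_eq sA) => //; apply: near_ptE => q iq.
by rewrite !rep_coord.
Qed.

Lemma smooth_fieldD X Y p : smooth_field_at X p -> smooth_field_at Y p ->
  smooth_field_at (fun q => X q + Y q) p.
Proof.
move=> [Xt sX] [Yt sY]; split=> [|i ip].
  by apply: near_ptS2 Xt Yt => q; exact: is_tangentD.
apply: smooth_near_eq (smooth_nearD (sX i ip) (sY i ip)).
apply: (rep_near_eq sA) => //; apply: near_ptE => q iq.
by rewrite !rep_coord.
Qed.

Lemma smooth_field0 p : smooth_field_at (A := A) (fun=> 0) p.
Proof.
split=> [|i ip]; first by apply: near_ptE => q; exact: is_tangent0.
by apply: smooth_near_eq (rep_cst 0 ip) _; exact: smooth_near_cst.
Qed.

Lemma smooth_field_sum (I : Type) (r : seq I) (X : I -> T -> tvec A) p :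
  (forall a, smooth_field_at (X a) p) ->
  smooth_field_at (fun q => \sum_(a <- r) X a q) p.
Proof.
move=> sX; elim: r => [|a r IHr].
  by rewrite (_ : (fun _ => _) = fun=> 0); [exact: smooth_field0|
    apply/funext => q; rewrite big_nil].
rewrite (_ : (fun _ => _) = fun q => X a q + \sum_(b <- r) X b q).
  exact: smooth_fieldD.
by apply/funext => q; rewrite big_cons.
Qed.

Lemma conn_sum_dir p (I : Type) (r : seq I) (c : I -> R) (v : I -> tvec A) X :
  (forall a, is_tangent p (v a)) -> smooth_field_at X p ->
  nabla p (\sum_(a <- r) c a *: v a) X = \sum_(a <- r) c a *: nabla p (v a) X.
Proof.
move=> vT sX; elim: r => [|a r IHr]; last first.
  rewrite !big_cons (conn_linear cN) ?IHr//.
  by apply: is_tangent_sum => b; exact: is_tangentZ.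
rewrite !big_nil.
have := conn_linear cN 1 (is_tangent0 p) (is_tangent0 p) sX.
by rewrite !scale1r addr0 => /esym/eqP; rewrite -subr_eq0 addrK => /eqP.
Qed.

Lemma conn_sum p v (I : Type) (r : seq I) (X : I -> T -> tvec A) :
  is_tangent p v -> (forall a, smooth_field_at (X a) p) ->
  nabla p v (fun q => \sum_(a <- r) X a q) = \sum_(a <- r) nabla p v (X a).
Proof.
move=> vT sX; elim: r => [|a r IHr].
  have -> : (fun q => \sum_(a <- [::]) X a q) = fun=> 0.
    by apply/funext => q; rewrite big_nil.
  have := conn_additive cN vT (smooth_field0 p) (smooth_field0 p).
  rewrite (_ : (fun _ => _) = fun=> 0); last by apply/funext => q; rewrite addr0.
  by rewrite big_nil => /esym/eqP; rewrite -subr_eq0 addrK => /eqP.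
rewrite big_cons -IHr -(conn_additive cN)//; last exact: smooth_field_sum.
by congr (nabla p v _); apply/funext => q; rewrite big_cons.
Qed.

Lemma connZ p v c X i : is_tangent p v -> smooth_field_at X p -> dom i p ->
  nabla p v (fun q => c *: X q) i = c *: nabla p v X i.
Proof.
move=> vT sX ip; rewrite (conn_leibniz cN vT (@smooth_fun_cst c p) sX ip).
have E : 'd (rep 0 i (fun=> c)) (coord i p) (v i) = 0.
  apply: etrans _ (diff_cst_fun c (coord i p) (v i)).
  apply/esym/near_eq_diffE; last exact: differentiable_cst.
  by apply: (rep_near_eq sA) => //; exact: near_ptE.
by rewrite E scale0r add0r.
Qed.

Lemma smooth_field_near_eq X Y p : near_pt A p (fun q => X q = Y q) ->
  smooth_field_at X p -> smooth_field_at Y p.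
Proof.
move=> XY [Xt sX]; split=> [|i ip].
  by apply: near_ptS2 XY Xt => q <-.
apply: smooth_near_eq (sX i ip); apply: (rep_near_eq sA) => //.
by apply: near_ptS XY => q <- iq; rewrite rep_coord.
Qed.

(** The characteristic function of the set where two fields differ is smooth at a
    point near which they agree, and the Leibniz rule applied to it replaces the
    usual argument with a bump function. *)
Lemma conn_local p v X Y : is_tangent p v -> smooth_field_at X p ->
  near_pt A p (fun q => X q = Y q) -> nabla p v X = nabla p v Y.
Proof.
move=> vT sX XY; have sY := smooth_field_near_eq XY sX.
(* X = Y + f (X - Y), and both f and X - Y vanish at p. *)
pose f q : R := if pselect (X q = Y q) then 0 else 1.
have fE q : X q = Y q -> f q = 0 by rewrite /f; case: pselect.
have sf : smooth_fun_at A f p.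
  move=> i ip; apply: (@smooth_near_eq _ _ _ (fun=> 0)); last exact: smooth_near_cst.
  by apply: (rep_near_eq sA) => //; apply: near_ptS XY => q /fE -> _.
pose Z q := X q + -1 *: Y q.
have sZ : smooth_field_at Z p.
  by apply: smooth_fieldD => //; apply: smooth_fieldZ => //; exact: smooth_fun_cst.
have XYp : X p = Y p by exact: near_pt_self XY.
have -> : X = fun q => Y q + f q *: Z q.
  apply/funext => q; rewrite /f; case: pselect => [XYq|_] /=.
    by rewrite scale0r addr0.
  by rewrite scale1r /Z scaleN1r addrCA subrr addr0.
rewrite (conn_additive cN vT sY (smooth_fieldZ sf sZ)).
rewrite [X in _ + X](_ : _ = 0) ?addr0//; apply/funext => i.
have [ip|ip] := pselect (dom i p); last first.
  have [h _] := conn_tangent cN vT (smooth_fieldZ sf sZ); exact: h.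
rewrite (conn_leibniz cN vT sf sZ ip) (fE p XYp) scale0r addr0.
by rewrite [Z p](_ : _ = 0) ?scaler0// /Z XYp scaleN1r subrr.
Qed.

Lemma chart_field_sum (I : Type) (r : seq I) i (c : I -> T -> R)
    (x : I -> T -> 'rV[R]_n) :
  chart_field i (fun q => \sum_(a <- r) c a q *: x a q) =
  fun q => \sum_(a <- r) c a q *: chart_field i (x a) q.
Proof.
apply/funext => q; apply/funext => j; rewrite tvec_sum.
have ZE a : (c a q *: chart_field i (x a) q) j = c a q *: chart_field i (x a) q j.
  by [].
rewrite (eq_bigr _ (fun a _ => ZE a)) /chart_field.
case: asboolP => h; last by rewrite big1// => a _; exact: scaler0.
apply: etrans (linear_sum _ _ _ _) _; apply: eq_bigr => a _; exact: linearZ.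
Qed.

(** The covariant derivative of a field is the derivative of its components plus
    the term given by the Christoffel symbols, which is the covariant derivative
    of the field whose components are frozen at the base point. *)
Lemma conn_chart_field p v i (x : T -> 'rV[R]_n) : is_tangent p v -> dom i p ->
  smooth_near (rep 0 i x) (coord i p) ->
  nabla p v (chart_field i x) i =
  'd (rep 0 i x) (coord i p) (v i) + nabla p v (chart_field i (fun=> x p)) i.
Proof.
move=> vT ip sx; pose e m := chart_field i (fun=> delta_mx 0 m).
have se m : smooth_field_at (e m) p by exact: smooth_field_cst.
have xm m : \forall y \near coord i p, rep 0 i x y 0 m = rep 0 i (fun q => x q 0 m) y.
  by apply: (rep_near_eq sA) => //; apply: near_ptE => q iq; rewrite rep_coord.
have sfm m : smooth_fun_at A (fun q => x q 0 m) p.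
  move=> j jp; apply: (rep_smooth_chart sA ip jp).
  by apply: smooth_near_eq (xm m) _; exact: smooth_near_entry.
have scm m : smooth_fun_at A (fun=> x p 0 m) p by exact: smooth_fun_cst.
have nablaE (y : T -> 'rV[R]_n) : (forall m, smooth_fun_at A (fun q => y q 0 m) p) ->
    nabla p v (chart_field i y) i = \sum_m
      ('d (rep 0 i (fun q => y q 0 m)) (coord i p) (v i) *: delta_mx 0 m +
       y p 0 m *: nabla p v (e m) i).
  move=> sy.
  have -> : chart_field i y = fun q => \sum_m y q 0 m *: e m q.
    rewrite -chart_field_sum; congr (chart_field i _).
    by apply/funext => q; exact: row_sum_delta.
  rewrite conn_sum//; last by move=> m; exact: smooth_fieldZ.
  rewrite tvec_sum; apply: eq_bigr => m _.
  rewrite (conn_leibniz cN vT (sy m) (se m) ip); congr (_ *: _ + _).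
  exact: chart_field_coord.
have E0 : nabla p v (chart_field i (fun=> x p)) i = \sum_m x p 0 m *: nabla p v (e m) i.
  rewrite nablaE; last exact: scm.
  apply: eq_bigr => m _; rewrite [X in X *: _](_ : _ = 0) ?scale0r ?add0r//.
  apply: etrans _ (diff_cst_fun (x p 0 m) (coord i p) (v i)).
  apply/esym/near_eq_diffE; last exact: differentiable_cst.
  by apply: (rep_near_eq sA) => //; exact: near_ptE.
rewrite E0 nablaE; last exact: sfm.
rewrite big_split; congr (_ + _).
apply: etrans _ (esym (row_sum_delta _)); apply: eq_bigr => m _; congr (_ *: _).
apply: etrans (esym (near_eq_diffE _ (xm m) _)) _.
  exact/smooth_near_differentiable/smooth_near_entry.
exact: (diff_entry 0 m (v i) (smooth_near_differentiable sx)).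
Qed.

End Connection_theory.

(** * Reduction of the Chern connection *)

Section Chern_reduction.
Context {R : realType} {n : nat} {M : Type} {A : atlas R n M}.
Context {sigma : jet A 1 -> jet A 2} {nabla : covariant_derivative (atlas1 A)}.
Hypotheses (sA : smooth_atlas A) (hsigma : SODE sigma).
Hypothesis hnabla : chern_connection sigma nabla.
Implicit Types (i j : chart A) (xi : jet A 1) (u : frame_bundle (atlas1 A)).
Let s1 := smooth_atlas1 sA.
Let cN : linear_connection nabla := chern_linear hnabla.

Definition adapted_field i a : jet A 1 -> tvec (atlas1 A) :=
  chart_field (A := atlas1 A) i (fun q => row a (adapted_mx (sigma := sigma) i (coord1 i q))).

Lemma adapted_field_near0 i xi : dom (a := atlas1 A) i xi ->
  near_pt (atlas1 A) xi (fun q => adapted_field i X0_index q = Xsigma sigma q).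
Proof.
move=> ix; apply: near_ptS (near_pt_dom s1 ix) => q iq.
apply: (tangent_eq (chart_field_tangent s1 _ iq) (Xsigma_tangent sA hsigma q) iq).
by rewrite chart_field_coord// row0_adapted_mx// /Xsigma (asboolT (iq : dom i (target q))).
Qed.

Lemma adapted_field_nearh i xi k : dom (a := atlas1 A) i xi ->
  near_pt (atlas1 A) xi (fun q => adapted_field i (Xh_index k) q = Xh sigma i k q).
Proof.
move=> ix; apply: near_ptS (near_pt_dom s1 ix) => q iq.
by rewrite /adapted_field /Xh /chart_field rowh_adapted_mx.
Qed.

Lemma adapted_fieldv i k : adapted_field i (Xv_index k) = Xv i k.
Proof.
rewrite /adapted_field /Xv; congr (chart_field _ _).
by apply/funext => q; rewrite rowv_adapted_mx.
Qed.

Lemma smooth_linear_adapted_mx i xi m (L : {linear 'M[R]_(1 + (n + n)) -> 'rV[R]_m}) :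
  dom (a := atlas1 A) i xi ->
  smooth_near (fun y => L (adapted_mx (sigma := sigma) i y)) (coord1 i xi).
Proof. by move=> ix; exact: (smooth_near_linear L (adapted_mx_smooth sA hsigma ix)). Qed.

Lemma rep_linear_adapted_mx i xi m (L : {linear 'M[R]_(1 + (n + n)) -> 'rV[R]_m}) :
  dom (a := atlas1 A) i xi -> \forall y \near coord1 i xi,
    L (adapted_mx (sigma := sigma) i y) =
    rep (A := atlas1 A) 0 i (fun q => L (adapted_mx (sigma := sigma) i (coord1 i q))) y.
Proof. by move=> ix; apply: (rep_near_eq s1) => //; exact: near_ptE. Qed.

Lemma adapted_field_smooth i a xi : dom (a := atlas1 A) i xi ->
  smooth_field_at (adapted_field i a) xi.
Proof.
move=> ix; apply: (smooth_field_chart_field s1) => //.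
apply: smooth_near_eq (rep_linear_adapted_mx (@row R _ _ a) ix) _.
exact: smooth_linear_adapted_mx.
Qed.

(** In each of the defining formulas of the connection, the coefficients for
    X^sigma_k and for d/dx'^k are the same. *)
Lemma conn_adapted_dir i xi a : dom (a := atlas1 A) i xi ->
  exists Th : 'M[R]_n, forall k,
    nabla xi (adapted_field i a xi) (adapted_field i (Xh_index k)) =
      \sum_l Th k l *: adapted_field i (Xh_index l) xi /\
    nabla xi (adapted_field i a xi) (adapted_field i (Xv_index k)) =
      \sum_l Th k l *: adapted_field i (Xv_index l) xi.
Proof.
move=> ix; have X0E := near_pt_self s1 (adapted_field_near0 ix).
have XhE l := near_pt_self s1 (adapted_field_nearh l ix).
have nablah v k : is_tangent xi v ->
    nabla xi v (adapted_field i (Xh_index k)) = nabla xi v (Xh sigma i k).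
  move=> vT; apply: (conn_local s1 cN vT (adapted_field_smooth (Xh_index k) ix)).
  exact: adapted_field_nearh.
have sumN c (f : 'I_n -> R) (X : 'I_n -> tvec (atlas1 A)) :
    - (c *: \sum_l f l *: X l) = \sum_l - (c * f l) *: X l.
  by rewrite scaler_sumr -sumrN; apply: eq_bigr => l _; rewrite scalerA scaleNr.
have aT b : is_tangent xi (adapted_field i b xi) by exact: chart_field_tangent.
move: a; apply: frame_index_ind => [|b|b].
- exists (\matrix_(k, l) - (2^-1 * dF sigma i k l xi)) => k.
  rewrite (nablah _ _ (aT _)) X0E adapted_fieldv (chern_Xh hnabla ix) (chern_Xv hnabla ix).
  rewrite !sumN; split; apply: eq_bigr => l _; rewrite mxE ?XhE ?adapted_fieldv//.
- exists (\matrix_(k, l) - (2^-1 * d2F sigma i k b l xi)) => k.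
  rewrite (nablah _ _ (aT _)) XhE adapted_fieldv (chern_hh hnabla ix) (chern_hv hnabla ix).
  rewrite !sumN; split; apply: eq_bigr => l _; rewrite mxE ?XhE ?adapted_fieldv//.
- exists 0 => k.
  rewrite (nablah _ _ (aT _)) !adapted_fieldv (chern_vh hnabla ix) (chern_vv hnabla ix).
  by split; rewrite big1// => l _; rewrite mxE scale0r.
Qed.

Lemma adapted_field_coord i a xi : dom (a := atlas1 A) i xi ->
  adapted_field i a xi i = row a (adapted_mx (sigma := sigma) i (coord1 i xi)).
Proof. by move=> ix; rewrite /adapted_field chart_field_coord. Qed.

Lemma tangent_adapted_expansion i xi (Y : tvec (atlas1 A)) :
  dom (a := atlas1 A) i xi -> is_tangent xi Y ->
  exists c : 'I_(1 + (n + n)) -> R, Y = \sum_a c a *: adapted_field i a xi.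
Proof.
move=> ix YT; set P := adapted_mx (sigma := sigma) i (coord1 i xi).
exists (fun a => (Y i *m invmx P) 0 a); apply: (tangent_eq YT _ ix).
  by apply: is_tangent_sum => a; apply: is_tangentZ; exact: chart_field_tangent.
have PK : Y i *m invmx P *m P = Y i by apply: mulmxKV; exact: adapted_mx_unit.
rewrite tvec_sum -[LHS]PK mulmx_sum_row.
by apply: eq_bigr => a _; congr (_ *: _); rewrite adapted_field_coord.
Qed.

(** The matrix of the connection in the adapted frame is diag(0, Theta, Theta): the
    zero because X^sigma is parallel, and Theta is the combination of the matrices
    of [conn_adapted_dir] given by the components of [Y] in that frame. *)
Lemma conn_adapted_field i xi (Y : tvec (atlas1 A)) :
  dom (a := atlas1 A) i xi -> is_tangent xi Y ->
  exists Th : 'M[R]_n, forall a, nabla xi Y (adapted_field i a) i =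
    row a (frame_block 0 Th *m adapted_mx (sigma := sigma) i (coord1 i xi)).
Proof.
move=> ix YT; have [c Yc] := tangent_adapted_expansion ix YT.
have /choice[Th ThP] := fun a => conn_adapted_dir a ix.
have aT b : is_tangent xi (adapted_field i b xi) by exact: chart_field_tangent.
exists (\sum_a c a *: Th a); apply: frame_index_ind => [|k|k].
- have s0 := adapted_field_smooth X0_index ix.
  rewrite (conn_local s1 cN YT s0 (adapted_field_near0 ix)) (chern_X hnabla YT).
  by rewrite row0_frame_block scale0r.
- rewrite Yc (conn_sum_dir cN)//; last exact: adapted_field_smooth.
  rewrite rowh_frame_block tvec_sum.
  under [RHS]eq_bigr do rewrite summxE scaler_suml.
  rewrite exchange_big; apply: eq_bigr => a _.
  rewrite -[LHS]/(c a *: nabla xi _ _ i) (ThP a k).1 tvec_sum scaler_sumr.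
  by apply: eq_bigr => l _; rewrite mxE -scalerA -adapted_field_coord.
- rewrite Yc (conn_sum_dir cN)//; last exact: adapted_field_smooth.
  rewrite rowv_frame_block tvec_sum.
  under [RHS]eq_bigr do rewrite summxE scaler_suml.
  rewrite exchange_big; apply: eq_bigr => a _.
  rewrite -[LHS]/(c a *: nabla xi _ _ i) (ThP a k).2 tvec_sum scaler_sumr.
  by apply: eq_bigr => l _; rewrite mxE -scalerA -adapted_field_coord.
Qed.

Lemma conn_adapted_frame i xi (Y : tvec (atlas1 A)) (B : 'M[R]_(1 + (n + n))) :
  dom (a := atlas1 A) i xi -> is_tangent xi Y ->
  exists Th : 'M[R]_n, forall a, nabla xi Y (chart_field (A := atlas1 A) i (fun q =>
      row a (B *m adapted_mx (sigma := sigma) i (coord1 i q)))) i =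
    row a (B *m (frame_block 0 Th *m adapted_mx (sigma := sigma) i (coord1 i xi))).
Proof.
move=> ix YT; have [Th ThP] := conn_adapted_field ix YT; exists Th => a.
have sE b : smooth_field_at (adapted_field i b) xi by exact: adapted_field_smooth.
have -> : chart_field (A := atlas1 A) i (fun q =>
      row a (B *m adapted_mx (sigma := sigma) i (coord1 i q))) =
    fun q => \sum_b B a b *: adapted_field i b q.
  apply: etrans _ (chart_field_sum (A := atlas1 A) (index_enum _) i
    (fun b _ => B a b) (fun b q => row b (adapted_mx i (coord1 i q)))).
  congr (chart_field _ _).
  apply/funext => q; rewrite row_mul mulmx_sum_row.
  by apply: eq_bigr => b _; rewrite mxE.
rewrite (conn_sum s1 cN)//; last first.
  by move=> b; apply: smooth_fieldZ => //; exact: smooth_fun_cst.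
rewrite tvec_sum row_mul mulmx_sum_row; apply: eq_bigr => b _.
by rewrite (connZ s1 cN _ YT (sE b) ix) ThP mxE.
Qed.

(** In coordinates, a horizontal vector at the adapted frame with matrix
    diag(1, L, L) P(x) consists of a velocity x' and of the derivative along x' of
    that matrix, corrected by a matrix of the Lie algebra of the group. *)
Lemma horizontal_coord i u (L : 'M[R]_n) W : dom (a := atlas1 A) i (base u) ->
  frame_matrix (frame_of u) i =
    frame_block 1 L *m adapted_mx (sigma := sigma) i (coord1 i (base u)) ->
  horizontal nabla u W ->
  exists Th : 'M[R]_n, W i = row_mx (base_part W i)
    (mxvec ('d (fun y => frame_block 1 L *m adapted_mx (sigma := sigma) i y)
              (coord1 i (base u)) (base_part W i) -
      frame_block 0 Th *m adapted_mx (sigma := sigma) i (coord1 i (base u)))).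
Proof.
move=> iu uL [WT Wh]; have YT := base_part_tangent s1 WT.
have [Th ThP] := conn_adapted_frame (frame_block 1 L) iu YT.
(* diag(1, L, L) diag(0, Th, Th) = diag(0, L Th, L Th). *)
exists (L *m Th); rewrite -[LHS]hsubmxK; congr row_mx.
rewrite -[LHS]vec_mxK; congr mxvec; apply/row_matrixP => a.
set P := adapted_mx (sigma := sigma) i in ThP *.
set y0 := coord1 i (base u) in ThP uL *; set Y := base_part W in YT ThP *.
have sP : smooth_near (fun y => frame_block 1 L *m P y) y0.
  exact: (smooth_near_mulmx (smooth_near_cst _ _) (adapted_mx_smooth sA hsigma iu)).
have sr : smooth_near (fun y => row a (frame_block 1 L *m P y)) y0.
  exact: (smooth_near_linear (@row R _ _ a) sP).
pose x q := row a (frame_block 1 L *m P (coord1 i q)).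
have rx : \forall y \near y0, row a (frame_block 1 L *m P y) =
    rep (A := atlas1 A) 0 i x y.
  by apply: (rep_near_eq s1) => //; exact: near_ptE.
have := Wh i iu a; have <- : x (base u) = frame_of u a i.
  by rewrite /x -uL row_frame_matrix.
have E := etrans (esym (ThP a))
  (conn_chart_field s1 cN YT iu (smooth_near_eq rx sr)).
have dE : 'd (rep (A := atlas1 A) 0 i x) y0 (Y i) =
    row a ('d (fun y => frame_block 1 L *m P y) y0 (Y i)).
  apply: etrans (esym (near_eq_diffE _ rx (smooth_near_differentiable sr))) _.
  exact: (diff_linear_comp (@row R _ _ a) (Y i) (smooth_near_differentiable sP)).
have {}E := etrans E (congr1 (fun w => w + _) dE).
move/eqP; rewrite addr_eq0 => /eqP Wa.
(* The covariant derivative of the field with frozen components is that of the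
   moving frame minus the derivative of its components. *)
apply: etrans Wa _; rewrite linearB /= -[X in - X](addKr (row a ('d (fun y =>
  frame_block 1 L *m P y) y0 (Y i)))) -E opprD opprK mulmxA frame_blockM mul1r.
by [].
Qed.

(** The horizontal vector is the velocity of a curve of frames with matrices
    diag(1, L - s Th, L - s Th) P(x + s x'), all of which are adapted. *)
Lemma horizontal_tangent u : adapted_frames sigma u ->
  horizontal nabla u `<=` tangent_to (adapted_frames sigma) u.
Proof.
move=> uQ W hW; have [i iu] := atlas_cover sA (target (base u)).
have iu1 : dom (a := atlas1 A) i (base u) by [].
have sF := smooth_frame_atlas s1.
have [L uL] := (adapted_framesP sA hsigma iu).1 uQ.
have [Th WE] := horizontal_coord iu1 uL hW.
set y0 := coord1 i (base u) in uL WE; set x' := base_part W i in WE.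
pose P := adapted_mx (sigma := sigma) i.
pose p1 y := frame_block 1 L *m P y; pose p0 y := frame_block 0 Th *m P y.
have sp1 : smooth_near p1 y0.
  exact: (smooth_near_mulmx (smooth_near_cst _ _) (adapted_mx_smooth sA hsigma iu)).
have sp0 : smooth_near p0 y0.
  exact: (smooth_near_mulmx (smooth_near_cst _ _) (adapted_mx_smooth sA hsigma iu)).
(* The shift by 0 is that of [smooth_near_line]. *)
pose ell (s : R) := y0 + (s - 0) *: x'.
have ell0 : ell 0 = y0 by rewrite /ell subrr scale0r addr0.
have sl : smooth_near ell 0 by exact: smooth_near_line.
have dl : 'd ell 0 1 = x'.
  exact: etrans (esym (derive1_diff sl)) (derive1_line y0 x' 0 0).
pose c (s : R) : R := 0 + (s - 0) *: (-1 : R).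
have c0 : c 0 = 0 by rewrite /c subrr scale0r addr0.
have sc : smooth_near c 0 by exact: smooth_near_line.
have dc : 'd c 0 1 = -1.
  have E := derive1_line (0 : R) (-1 : R) 0 0.
  by rewrite -[LHS](derive1_diff sc).
have sp1l : smooth_near (fun s => p1 (ell s)) 0.
  by apply: smooth_near_comp => //; rewrite ell0.
have sp0l : smooth_near (fun s => p0 (ell s)) 0.
  by apply: smooth_near_comp => //; rewrite ell0.
pose m (s : R) := p1 (ell s) + c s *: p0 (ell s).
have mE s : m s = frame_block 1 (c s *: Th + L) *m P (ell s).
  have <- : frame_block 1 L + c s *: frame_block 0 Th = frame_block 1 (c s *: Th + L).
    by rewrite addrC frame_block_linear mulr0 add0r.
  by rewrite mulmxDl -scalemxAl.
have scp0 : smooth_near (fun s => c s *: p0 (ell s)) 0 by exact: smooth_nearZ.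
have sm : smooth_near m 0 by exact: smooth_nearD.
have dm : 'd m 0 1 = 'd p1 y0 x' - p0 y0.
  have E := diffD_fun (1 : R) (smooth_near_differentiable sp1l)
    (smooth_near_differentiable scp0).
  apply: etrans E _.
  congr (_ + _).
    have sp1' : smooth_near p1 (ell 0) by rewrite ell0.
    apply: etrans (diff_compE (1 : R) (smooth_near_differentiable sl)
      (smooth_near_differentiable sp1')) _.
    by rewrite ell0; exact: (congr1 ('d p1 y0) dl).
  apply: etrans (diffZ_fun (1 : R) (smooth_near_differentiable sc)
    (smooth_near_differentiable sp0l)) _.
  rewrite c0 scale0r add0r ell0.
  exact: etrans (congr1 (fun r => r *: p0 y0) dc) (scaleN1r _).
pose gamma s := row_mx (ell s) (mxvec (m s)).
have smv : smooth_near (fun s => mxvec (m s)) 0.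
  exact: (smooth_near_linear (@mxvec R _ _) sm).
have sg : smooth_near gamma 0 by exact: smooth_near_row_mx.
have dg : derive1 gamma 0 = W i.
  rewrite derive1_diff// WE; apply: etrans (diff_row_mx (1 : R) sl smv) _.
  congr row_mx; first exact: dl.
  apply: etrans (diff_linear_comp (@mxvec R _ _) (1 : R) (smooth_near_differentiable sm)) _.
  exact: (congr1 (fun X => mxvec X) dm).
have g0 : gamma 0 = coord (a := frame_atlas (atlas1 A)) i u.
  by rewrite /gamma ell0 /m c0 scale0r addr0 ell0 /p1 -uL.
have [k [k0 kg sk]] := lift_curve sF (i := i) iu1 sg g0.
exists k; split=> //.
  apply: filterS kg => s [ik /eq_row_mx[bk /(can_inj mxvecK) fk]].
  apply/(adapted_framesP sA hsigma (i := i)); first exact: ik.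
  have {}bk : coord1 i (base (k s)) = ell s by exact: bk.
  by exists (c s *: Th + L); rewrite bk; exact: etrans fk (mE s).
have iu2 : dom (a := frame_atlas (atlas1 A)) i u by [].
apply: (tangent_eq hW.1 _ iu2).
  by rewrite -k0; exact: (velocity_tangent sF sk).
rewrite /velocity asboolT; last by rewrite /= k0.
apply: etrans (esym dg) _; apply: near_eq_derive1.
by apply: filterS kg => s [].
Qed.

End Chern_reduction.

Theorem proposition3p7 (R : realType) (n : nat) (M : topologicalType)
    (A : atlas R n M) (sigma : jet A 1 -> jet A 2)
    (nabla : covariant_derivative (atlas1 A)) :
  connected_manifold A ->
  SODE sigma ->
  chern_connection sigma nabla ->
  reducible_to nabla (adapted_group R n) (adapted_frames sigma).
Proof.
move=> /manifold_atlas sA hsigma hnabla; split; first exact: adapted_G_structure.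
by move=> u; exact: horizontal_tangent.
Qed.
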